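(* Let $\Omega$ be an alphabet, and let $P$ be a computable finite probability space on $\Omega$. Let $X\colon\Omega\to\mathbb{R}$ be a real random variable on $\Omega$ such that $X(a)$ is a rational for all $a\in\Omega$ and $V(X)>0$. Let $\alpha\in\Omega^\infty$ be Schnorr $P$-random. Then, for every real $t>0$, the following conditions (i) and (ii) are equivalent: (i) There exists $M\in\mathbb{N}^+$ such that for every integer $n\ge M$ and every $k\in\mathbb{N}^+$, if $k\ge n^t$ then $$\left|\frac{1}{k}\sum_{i=1}^k X(\alpha(i))-E(X)\right|<\frac{1}{n}.$$ (ii) $t>2$.
   Context: $\mathbb{N}=\{0,1,2,\dots\}$ and $\mathbb{N}^+$ is the set of positive integers. An alphabet is a non-empty finite set. For an alphabet $\Omega$, $\Omega^*$ is the set of finite strings over $\Omega$ (including the empty string) and $\Omega^\infty$ is the set of infinite sequences $\alpha=\alpha(1)\alpha(2)\cdots$ over $\Omega$; $\alpha(i)$ is the $i$th element and $\alpha\restriction_n$ is the string of the first $n$ elements of $\alpha$. For $S\subset\Omega^*$, $[S]^{\prec}=\{\alpha\in\Omega^\infty\mid \exists n\in\mathbb{N}\ \alpha\restriction_n\in S\}$. A finite probability space on $\Omega$ is a function $P\colon\Omega\to\mathbb{R}$ with $P(a)\ge 0$ for all $a\in\Omega$ and $\sum_{a\in\Omega}P(a)=1$. A real $x$ is computable if there is a total recursive $f\colon\mathbb{N}\to\mathbb{Q}$ with $|x-f(k)|<2^{-k}$ for all $k\in\mathbb{N}$; $P$ is computable if $P(a)$ is a computable real for every $a\in\Omega$.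 The Bernoulli measure $\lambda_P$ is the probability measure on the Borel $\sigma$-field of $\Omega^\infty$ (generated by all sets $[S]^{\prec}$) with $\lambda_P([\{\sigma_1\cdots\sigma_n\}]^{\prec})=P(\sigma_1)\cdots P(\sigma_n)$ for every string $\sigma_1\cdots\sigma_n\in\Omega^*$. A real random variable on $\Omega$ is a function $X\colon\Omega\to\mathbb{R}$; its mean is $E(X)=\sum_{a\in\Omega}X(a)P(a)$ and its variance is $V(X)=\sum_{a\in\Omega}(X(a)-E(X))^2P(a)$. A Martin-Löf $P$-test is an r.e. (recursively enumerable) set $\mathcal{C}\subset\mathbb{N}^+\times\Omega^*$ such that $\lambda_P([\mathcal{C}_n]^{\prec})<2^{-n}$ for every $n\in\mathbb{N}^+$, where $\mathcal{C}_n=\{\sigma\mid(n,\sigma)\in\mathcal{C}\}$. A Schnorr $P$-test is a Martin-Löf $P$-test $\mathcal{C}$ for which there is a total recursive $f\colon\mathbb{N}^+\times\mathbb{N}\to\mathbb{Q}$ with $|\lambda_P([\mathcal{C}_n]^{\prec})-f(n,k)|<2^{-k}$ for all $n\in\mathbb{N}^+$, $k\in\mathbb{N}$. A sequence $\alpha\in\Omega^\infty$ passes $\mathcal{C}$ if $\alpha\notin[\mathcal{C}_n]^{\prec}$ for some $n\in\mathbb{N}^+$. $\alpha$ is Schnorr $P$-random if it passes every Schnorr $P$-test. *)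

(* Defs.v *)
(* MathComp / MathComp-Analysis *)
From HB Require Import structures.
From mathcomp Require Import all_boot all_order all_algebra.
From mathcomp Require Import all_classical all_reals all_analysis.

Set Implicit Arguments.
Unset Strict Implicit.
Unset Printing Implicit Defensive.

Import Order.TTheory GRing.Theory Num.Theory.
Import numFieldNormedType.Exports.

Local Open Scope classical_set_scope.
Local Open Scope ring_scope.

(* Terms for Kleene's partial recursive functions, indexed by arity:
   [RComp f g] is the composition f(g_0(v), ..., g_(m-1)(v)); [RPrec f g]
   recurses on the first argument, from f(v), with step g(i, previous, v);
   [RMin f] is the least y with f(y, v) = 0. *)
Inductive recf : nat -> Type :=
| RZero : recf 0
| RSucc : recf 1
| RProj n of 'I_n : recf n
| RComp m n of recf m & ('I_m -> recf n) : recf n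
| RPrec n of recf n & recf n.+2 : recf n.+1
| RMin n of recf n.+1 : recf n.

(* [reval f v y]: the function denoted by f is defined at v, with value y.
   In the [RPrec] case, s lists the successive values of the recursion; in the
   [RMin] case, f must be defined (and nonzero) at all arguments below y. *)
Fixpoint reval n (f : recf n) : n.-tuple nat -> nat -> Prop :=
  match f in recf n return n.-tuple nat -> nat -> Prop with
  | RZero => fun _ y => y = 0%N
  | RSucc => fun v y => y = (thead v).+1
  | RProj _ i => fun v y => y = tnth v i
  | RComp m _ f g => fun v y =>
      exists w : m.-tuple nat,
        (forall i, reval (g i) v (tnth w i)) /\ reval f w y
  | RPrec _ f g => fun v y =>
      exists s : nat -> nat,
        [/\ reval f (behead_tuple v) (s 0%N),
            (forall i, (i < thead v)%N ->
               reval g (cons_tuple i (cons_tuple (s i) (behead_tuple v)))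
                     (s i.+1))
          & y = s (thead v)]
  | RMin _ f => fun v y =>
      reval f (cons_tuple y v) 0%N /\
      (forall z, (z < y)%N -> exists u, reval f (cons_tuple z v) u.+1)
  end.

Definition total_recursive n (f : n.-tuple nat -> nat) : Prop :=
  exists p : recf n, forall v y, reval p v y <-> y = f v.

(* Rationals are coded by triples (a, b, c) standing for (a - b) / (c + 1). *)
Definition total_recursive_rat n (f : n.-tuple nat -> rat) : Prop :=
  exists a b c : n.-tuple nat -> nat,
    [/\ total_recursive a, total_recursive b, total_recursive c &
        forall v, f v = ((a v)%:R - (b v)%:R) / (c v).+1%:R].

Definition computable_real (R : realType) (x : R) : Prop :=
  exists f : 1.-tuple nat -> rat,
    total_recursive_rat f /\
    forall k : nat, `|x - ratr (f [tuple k])| < 2 ^- k.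

(* Non-emptiness is witnessed by [point], as MathComp-Analysis requires of the
   carrier of a measurable space; which letter it is plays no role. *)
#[short(type="alphabetType")]
HB.structure Definition Alphabet := {T of Finite T & isPointed T}.

(* An infinite sequence is a function [nat -> Omega] indexed from 0, so that
   alpha(i) is [alpha i.-1] and the length-n prefix of alpha is
   [mkseq alpha n]. *)
Definition open_of (Omega : Type) (S : set (seq Omega)) : set (nat -> Omega) :=
  [set alpha | exists n, S (mkseq alpha n)].

Notation seq_space Omega :=
  (g_sigma_algebraType (range (@open_of Omega))).

Definition finite_prob_space (R : realType) (Omega : finType) (P : Omega -> R)
    : Prop :=
  (forall a, 0 <= P a) /\ \sum_a P a = 1.

Definition computable_prob_space (R : realType) (Omega : finType)
    (P : Omega -> R) : Prop :=
  finite_prob_space P /\ forall a, computable_real (P a).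

Definition rv_mean (R : realType) (Omega : finType) (P X : Omega -> R) : R :=
  \sum_a X a * P a.

Definition rv_variance (R : realType) (Omega : finType) (P X : Omega -> R)
    : R :=
  \sum_a (X a - rv_mean P X) ^+ 2 * P a.

Definition is_bernoulli_measure (R : realType) (Omega : alphabetType)
    (P : Omega -> R) (lam : probability (seq_space Omega) R) : Prop :=
  forall s : seq Omega, lam (open_of [set s]) = (\prod_(a <- s) P a)%:E.

(* Bijective base-#|Omega| numeration: a computable bijection from the strings
   over Omega onto nat. *)
Definition string_code (Omega : finType) (s : seq Omega) : nat :=
  foldl (fun c a => c * #|Omega| + (enum_rank a).+1)%N 0%N s.

(* C is a subset of {1, 2, ...} * Omega^*, and is the domain of a partial
   recursive function. *)
Definition re_set (Omega : finType) (C : set (nat * seq Omega)) : Prop :=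
  (forall n s, C (n, s) -> (0 < n)%N) /\
  exists p : recf 2, forall n s, (0 < n)%N ->
    (C (n, s) <-> exists y, reval p [tuple n; string_code s] y).

Definition section (Omega : Type) (C : set (nat * seq Omega)) (n : nat)
    : set (seq Omega) :=
  [set s | C (n, s)].

Definition martin_lof_test (R : realType) (Omega : alphabetType)
    (lam : probability (seq_space Omega) R) (C : set (nat * seq Omega))
    : Prop :=
  re_set C /\
  forall n, (0 < n)%N -> (lam (open_of (section C n)) < (2 ^- n)%:E)%E.

Definition schnorr_test (R : realType) (Omega : alphabetType)
    (lam : probability (seq_space Omega) R) (C : set (nat * seq Omega))
    : Prop :=
  martin_lof_test lam C /\
  exists f : 2.-tuple nat -> rat,
    total_recursive_rat f /\
    forall n k : nat, (0 < n)%N ->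
      `|fine (lam (open_of (section C n))) - ratr (f [tuple n; k])| < 2 ^- k.

Definition passes (Omega : Type) (alpha : nat -> Omega)
    (C : set (nat * seq Omega)) : Prop :=
  exists2 n, (0 < n)%N & ~ open_of (section C n) alpha.

Definition schnorr_random (R : realType) (Omega : alphabetType)
    (lam : probability (seq_space Omega) R) (alpha : nat -> Omega) : Prop :=
  forall C, schnorr_test lam C -> passes alpha C.

(* Main.v *)
(* After clearing denominators, [X] takes values in the natural numbers; write
   [S_k] for the sum of the first [k] centered values along a sequence.

   [2 < t] is sufficient because [|S_k| < k ^ (1/2 + 1/(2q))] holds eventually,
   for every [q]: exponential moments give [E S_k^(4q) = O(k^(2q))], so the
   violation at [k] has probability [O(k^-2)], whose tail sums are small with an
   explicit bound.

   [2 < t] is necessary because [|S_(n^2)| >= A n] holds for infinitely many [n],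
   for every [A].  Put [n_j = L ^ 2 ^ j], so that [n_(j+1)^2 = n_j^4] and the past
   up to time [n_j^2] contributes only [O(n_(j+1))] to the sum at time
   [n_(j+1)^2].  By the Paley-Zygmund inequality and a concatenation of [L] blocks
   of the same sign, each new stretch exceeds any prescribed multiple of [n_(j+1)]
   with probability at least [p > 0], whatever the past.  Hence [i] consecutive
   failures have probability at most [(1 - p) ^ i].

   Both events become decidable, hence yield Schnorr tests, when the mean of the
   first [k] values is replaced by a computable integer within distance 2. *)
Require Import Defs.
From HB Require Import structures.
From mathcomp Require Import all_boot all_order all_algebra.
From mathcomp Require Import all_classical all_reals all_analysis.
From mathcomp Require Import zify ring lra.

Set Implicit Arguments.
Unset Strict Implicit.
Unset Printing Implicit Defensive.

Import Order.TTheory GRing.Theory Num.Theory.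
Import numFieldNormedType.Exports.

Local Open Scope nat_scope.

(** * Closure properties of the recursive functions *)

(* Functions of [n] variables read their arguments off an environment, so that
   binding operators extend the environment at its head. *)
Definition recursive n (F : seq nat -> nat) : Prop :=
  total_recursive (fun v : n.-tuple nat => F v).

Lemma recursive_ext n (F G : seq nat -> nat) :
  (forall e, size e = n -> F e = G e) -> recursive n F -> recursive n G.
Proof.
move=> FG [p hp]; exists p => v y; rewrite hp.
by rewrite FG// size_tuple.
Qed.

Lemma recursive_var n i : i < n -> recursive n (fun e => nth 0 e i).
Proof.
move=> lt_in; exists (RProj (Ordinal lt_in)) => v y /=.
by rewrite (tnth_nth 0).
Qed.

(** The inner environment is rebuilt by [mkseq], so that [F] still reads its arguments off a list.
    Terms for the [g i] with [i < m] are gathered by choice, since [RComp] takes a function on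
    ['I_m]. *)
Lemma recursive_comp m n F (g : nat -> seq nat -> nat) :
  recursive m F -> (forall i, i < m -> recursive n (g i)) ->
  recursive n (fun e => F (mkseq (g ^~ e) m)).
Proof.
move=> [p hp] hg.
have /choice[q hq] : forall i : 'I_m, exists q : recf n,
    forall v y, reval q v y <-> y = g i v.
  by move=> i; case: (hg i (ltn_ord i)) => q hq; exists q.
exists (RComp p q) => v y /=; split => [[w [hw /hp ->]]|->].
  congr F; apply: (@eq_from_nth _ 0) => [|i]; rewrite size_tuple ?size_mkseq//.
  move=> lt_im; rewrite nth_mkseq//.
  by have /hq := hw (Ordinal lt_im); rewrite (tnth_nth 0).
exists [tuple g i v | i < m]; split=> [i|].
  by apply/hq; rewrite tnth_mktuple.
apply/hp; congr F; apply: (@eq_from_nth _ 0) => [|i].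
  by rewrite size_mkseq size_tuple.
rewrite size_mkseq => lt_im; rewrite nth_mkseq//.
by rewrite -[i]/(nat_of_ord (Ordinal lt_im)) -tnth_nth tnth_mktuple.
Qed.

Lemma recursive_weaken n F :
  recursive n F -> recursive n.+1 (fun e => F (behead e)).
Proof.
move=> hF; apply: (@recursive_ext _ (fun e =>
  F (mkseq (fun i => nth 0 e i.+1) n))).
  move=> e he; congr F; apply: (@eq_from_nth _ 0).
    by rewrite size_mkseq size_behead he.
  by move=> i; rewrite size_mkseq => hi; rewrite nth_mkseq// nth_behead.
apply: (@recursive_comp _ _ _ (fun i e => nth 0 e i.+1)) => // i hi.
exact: recursive_var.
Qed.

Lemma recursive_head n : recursive n.+1 (head 0).
Proof. by apply: (@recursive_ext _ (fun e => nth 0 e 0)) => //; apply: recursive_var. Qed.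

(** Substitutes a computed value for the head variable, like a let-binding. [RPrec] recurses on its
    first argument, whereas the bounds used below are functions of the environment. *)
Lemma recursive_bind n (g : seq nat -> nat) (F : nat -> seq nat -> nat) :
  recursive n.+1 (fun e => F (head 0 e) (behead e)) -> recursive n g ->
  recursive n (fun e => F (g e) e).
Proof.
move=> hF hg.
pose g' i e := if i is j.+1 then nth 0 e j else g e.
have : recursive n (fun e => F (head 0 (mkseq (g' ^~ e) n.+1))
                               (behead (mkseq (g' ^~ e) n.+1))).
  apply: (recursive_comp hF) => -[|i] hi //=; exact: recursive_var.
apply: recursive_ext => e he /=; congr F.
apply: (@eq_from_nth _ 0) => [|i]; rewrite size_map size_iota// => hi.
by rewrite (nth_map 0) ?size_iota// nth_iota.
Qed.

Lemma recursive_prec n (B f : seq nat -> nat) (G : nat -> nat -> seq nat -> nat) :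
  recursive n B -> recursive n f ->
  recursive n.+2 (fun e => G (nth 0 e 0) (nth 0 e 1) (behead (behead e))) ->
  recursive n (fun e => iteri (B e) (fun i x => G i x e) (f e)).
Proof.
move=> hB [pf hf] [pg hg].
apply: (@recursive_bind _ B (fun b e => iteri b (fun i x => G i x e) (f e))) => //.
exists (RPrec pf pg) => v y /=.
set v' := behead_tuple v.
have -> : head 0 v = thead v by rewrite /thead (tnth_nth 0) nth0.
split=> [[s [/hf s0 hs ->]]|->].
  (* The semantics constrains [s] only up to the bound; induction on the bound shows that it agrees
     with the iteration there. *)
  elim: (thead v) hs => [|k IHk] hs //=.
  have /hg -> /= := hs k (ltnSn _); congr G.
  by rewrite IHk// => i hi; apply: hs; rewrite ltnS ltnW.
exists (fun k => iteri k (fun i x => G i x v') (f v')); split=> //.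
- by apply/hf.
- by move=> i hi; apply/hg.
Qed.

Lemma recursive0 n : recursive n (fun _ => 0).
Proof.
have h : recursive 0 (fun _ => 0) by exists RZero.
by apply: (@recursive_comp _ _ _ (fun _ _ => 0) h).
Qed.

Lemma recursive_succ n f : recursive n f -> recursive n (fun e => (f e).+1).
Proof.
have h : recursive 1 (fun e => (head 0 e).+1).
  exists RSucc => v y /=.
  by have -> : head 0 v = thead v by rewrite /thead (tnth_nth 0) nth0.
by move=> hf; apply: (recursive_comp (g := fun _ => f) h).
Qed.

Lemma recursive_const n k : recursive n (fun _ => k).
Proof.
elim: k => [|k IHk]; first exact: recursive0.
exact: recursive_succ IHk.
Qed.

Lemma recursive_app1 (F : nat -> nat) n f :
  recursive 1 (fun e => F (nth 0 e 0)) -> recursive n f ->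
  recursive n (fun e => F (f e)).
Proof. by move=> hF hf; apply: (recursive_comp (g := fun _ => f) hF). Qed.

Lemma recursive_app2 (F : nat -> nat -> nat) n f g :
  recursive 2 (fun e => F (nth 0 e 0) (nth 0 e 1)) ->
  recursive n f -> recursive n g -> recursive n (fun e => F (f e) (g e)).
Proof.
move=> hF hf hg.
by apply: (recursive_comp (g := fun i => if i is 0 then f else g) hF) => -[].
Qed.

Lemma recursive_add n f g : recursive n f -> recursive n g ->
  recursive n (fun e => f e + g e).
Proof.
move=> hf hg; apply: (@recursive_ext _
    (fun e => iteri (g e) (fun _ x => x.+1) (f e))).
  by move=> e _; elim: (g e) => [|k /= ->]; rewrite ?addn0// addnS.
by apply: (recursive_prec (G := fun _ x _ => x.+1)) => //; apply: recursive_succ;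
  exact: recursive_var.
Qed.

Lemma recursive_mul n f g : recursive n f -> recursive n g ->
  recursive n (fun e => f e * g e).
Proof.
move=> hf hg; apply: (@recursive_ext _
    (fun e => iteri (g e) (fun _ x => f e + x) 0)).
  by move=> e _; elim: (g e) => [|k /= ->]; rewrite ?muln0// mulnS.
apply: (recursive_prec (G := fun _ x e => f e + x)) => //; first exact: recursive0.
by apply: recursive_add (recursive_weaken (recursive_weaken hf)) _; apply: recursive_var.
Qed.

Lemma recursive_exp n f g : recursive n f -> recursive n g ->
  recursive n (fun e => f e ^ g e).
Proof.
move=> hf hg; apply: (@recursive_ext _
    (fun e => iteri (g e) (fun _ x => f e * x) 1)).
  by move=> e _; elim: (g e) => [|k /= ->]; rewrite ?expn0// expnS.
apply: (recursive_prec (G := fun _ x e => f e * x)) => //; first exact: recursive_const.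
by apply: recursive_mul (recursive_weaken (recursive_weaken hf)) _; apply: recursive_var.
Qed.

Lemma recursive_pred n f : recursive n f -> recursive n (fun e => (f e).-1).
Proof.
move=> hf; apply: (@recursive_ext _ (fun e => iteri (f e) (fun i _ => i) 0)).
  by move=> e _; case: (f e).
by apply: (recursive_prec (G := fun i _ _ => i)) => //;
  [exact: recursive0 | apply: recursive_var].
Qed.

Lemma recursive_sub n f g : recursive n f -> recursive n g ->
  recursive n (fun e => f e - g e).
Proof.
move=> hf hg; apply: (@recursive_ext _
    (fun e => iteri (g e) (fun _ x => x.-1) (f e))).
  by move=> e _; elim: (g e) => [|k /= ->]; rewrite ?subn0// subnS.
by apply: (recursive_prec (G := fun _ x _ => x.-1)) => //; apply: recursive_pred;
  exact: recursive_var.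
Qed.

Lemma recursive_leq n f g : recursive n f -> recursive n g ->
  recursive n (fun e => (f e <= g e) : nat).
Proof.
move=> hf hg; apply: (@recursive_ext _ (fun e => 1 - (f e - g e))).
  by move=> e _; rewrite -subn_eq0; case: (f e - g e).
by do !apply: recursive_sub => //; exact: recursive_const.
Qed.

Lemma recursive_and n (f g : seq nat -> bool) : recursive n f -> recursive n g ->
  recursive n (fun e => (f e && g e) : nat).
Proof.
move=> hf hg; apply: (@recursive_ext _ (fun e => f e * g e)).
  by move=> e _; rewrite mulnb.
exact: recursive_mul.
Qed.

Lemma recursive_neg n (f : seq nat -> bool) : recursive n f ->
  recursive n (fun e => (~~ f e) : nat).
Proof.
move=> hf; apply: (@recursive_ext _ (fun e => 1 - f e)).
  by move=> e _; case: (f e).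
by apply: recursive_sub => //; apply: recursive_const.
Qed.

Lemma recursive_eq n f g : recursive n f -> recursive n g ->
  recursive n (fun e => (f e == g e) : nat).
Proof.
move=> hf hg; apply: (@recursive_ext _ (fun e => ((f e <= g e) && (g e <= f e)) : nat)).
  by move=> e _; rewrite eqn_leq.
by apply: recursive_and; apply: recursive_leq.
Qed.

Lemma recursive_iteri n (op : nat -> nat -> nat) x0 B
    (G : nat -> seq nat -> nat) :
  recursive 2 (fun e => op (nth 0 e 0) (nth 0 e 1)) -> recursive n B ->
  recursive n.+1 (fun e => G (head 0 e) (behead e)) ->
  recursive n (fun e => iteri (B e) (fun i x => op x (G i e)) x0).
Proof.
move=> hop hB hG.
apply: (recursive_prec (G := fun i x e => op x (G i e))) => //.
  exact: recursive_const.
apply: (recursive_app2 hop); first exact: recursive_var.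
(* The environment of the step starts with the counter and the accumulator; [g] skips the
   accumulator, which [G] does not read. *)
pose g i e := if i is 0 then nth 0 e 0 else nth 0 e i.+1.
have : recursive n.+2 (fun e =>
    G (head 0 (mkseq (g ^~ e) n.+1)) (behead (mkseq (g ^~ e) n.+1))).
  by apply: (recursive_comp hG) => -[|i] hi; apply: recursive_var.
apply: recursive_ext => e he /=; congr G.
apply: (@eq_from_nth _ 0) => [|i]; rewrite size_map size_iota.
  by rewrite !size_behead he.
by move=> hi; rewrite (nth_map 0) ?size_iota// nth_iota//= !nth_behead.
Qed.

Lemma recursive_sum n B (G : nat -> seq nat -> nat) : recursive n B ->
  recursive n.+1 (fun e => G (head 0 e) (behead e)) ->
  recursive n (fun e => \sum_(i < B e) G i e).
Proof.
move=> hB hG; have hop : recursive 2 (fun e => nth 0 e 0 + nth 0 e 1).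
  by apply: recursive_add; apply: recursive_var.
apply: recursive_ext (recursive_iteri 0 hop hB hG) => e _.
by elim: (B e) => [|k /= ->]; rewrite ?big_ord0// big_ord_recr.
Qed.

Lemma recursive_prod n B (G : nat -> seq nat -> nat) : recursive n B ->
  recursive n.+1 (fun e => G (head 0 e) (behead e)) ->
  recursive n (fun e => \prod_(i < B e) G i e).
Proof.
move=> hB hG; have hop : recursive 2 (fun e => nth 0 e 0 * nth 0 e 1).
  by apply: recursive_mul; apply: recursive_var.
apply: recursive_ext (recursive_iteri 1 hop hB hG) => e _.
by elim: (B e) => [|k /= ->]; rewrite ?big_ord0// big_ord_recr.
Qed.

Lemma recursive_all n B (G : nat -> seq nat -> bool) : recursive n B ->
  recursive n.+1 (fun e => G (head 0 e) (behead e)) ->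
  recursive n (fun e => all (G ^~ e) (iota 0 (B e)) : nat).
Proof.
move=> hB hG; apply: recursive_ext (recursive_prod (G := G) hB hG) => e _.
elim: (B e) => [|k IHk]; first by rewrite big_ord0.
have -> : iota 0 k.+1 = iota 0 k ++ [:: k] by rewrite -addn1 iotaD.
by rewrite big_ord_recr/= IHk all_cat/= andbT mulnb.
Qed.

Lemma recursive_has n B (G : nat -> seq nat -> bool) : recursive n B ->
  recursive n.+1 (fun e => G (head 0 e) (behead e)) ->
  recursive n (fun e => has (G ^~ e) (iota 0 (B e)) : nat).
Proof.
move=> hB hG; have := recursive_all (G := fun i e => ~~ G i e) hB.
move=> /(_ (recursive_neg hG)) /recursive_neg; apply: recursive_ext => e _.
by rewrite -has_predC; congr nat_of_bool; apply: eq_has => i /=; rewrite negbK.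
Qed.

Lemma recursive_div n f g : recursive n f -> recursive n g ->
  recursive n (fun e => f e %/ g e).
Proof.
(* The quotient counts the [i] with [i.+1 * g e <= f e]; the factor [0 < g e] reproduces the
   convention that division by zero gives zero. *)
move=> hf hg; apply: (@recursive_ext _
    (fun e => (0 < g e) * \sum_(i < f e) ((i.+1 * g e <= f e) : nat))).
  move=> e _; case: posnP => [->|g_gt0]; first by rewrite divn0.
  have -> m k : \sum_(i < k) ((i.+1 * g e <= m) : nat) = minn k (m %/ g e).
    elim: k => [|k IHk]; first by rewrite big_ord0 min0n.
    rewrite big_ord_recr/= IHk -leq_divRL//.
    by case: leqP => hm; rewrite ?addn1 ?addn0; lia.
  by rewrite mul1n; apply/minn_idPr; rewrite leq_div.
apply: recursive_mul.
  by apply: (@recursive_leq _ (fun=> 1)) => //; apply: recursive_const.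
apply: (recursive_sum (G := fun i e => (i.+1 * g e <= f e) : nat)) => //.
apply: recursive_leq; last exact: recursive_weaken.
by apply: recursive_mul (recursive_weaken hg); apply: recursive_succ;
  exact: recursive_head.
Qed.

Lemma recursive_mod n f g : recursive n f -> recursive n g ->
  recursive n (fun e => f e %% g e).
Proof.
move=> hf hg; apply: (@recursive_ext _ (fun e => f e - f e %/ g e * g e)).
  by move=> e _; rewrite {1}(divn_eq (f e) (g e)) addKn.
by apply: recursive_sub => //; apply: recursive_mul => //; apply: recursive_div.
Qed.

Lemma recursive_iter n B (G : nat -> nat) f : recursive n B -> recursive n f ->
  recursive 1 (fun e => G (nth 0 e 0)) ->
  recursive n (fun e => iter (B e) G (f e)).
Proof.
move=> hB hf hG; apply: (@recursive_ext _ (fun e => iteri (B e) (fun=> G) (f e))).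
  by move=> e _; elim: (B e) => //= k ->.
apply: (recursive_prec (G := fun _ x _ => G x)) => //.
by apply: recursive_app1 => //; apply: recursive_var.
Qed.

Lemma recursive_dist n f g : recursive n f -> recursive n g ->
  recursive n (fun e => (f e - g e) + (g e - f e)).
Proof. by move=> hf hg; apply: recursive_add; apply: recursive_sub. Qed.

(** * Strings and their codes *)

(** The code of a non-empty string is [c' * K + r + 1] with [r < K], where [c'] codes the string
    without its last letter. Subtracting 1 before dividing recovers [c'], and the code 0 of the
    empty string stays fixed. *)
Definition code_prefix K c := c.-1 %/ K.

Lemma string_code_rcons (Omega : finType) (s : seq Omega) a :
  string_code (rcons s a) = string_code s * #|Omega| + (enum_rank a).+1.
Proof. by rewrite /string_code -cats1 foldl_cat. Qed.

Lemma code_prefix_rcons (Omega : finType) (s : seq Omega) a :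
  code_prefix #|Omega| (string_code (rcons s a)) = string_code s.
Proof.
rewrite /code_prefix string_code_rcons addnS /= divnMDl ?divn_small ?addn0//.
by apply/card_gt0P; exists a.
Qed.

Lemma code_last_rcons (Omega : finType) (s : seq Omega) a :
  (string_code (rcons s a)).-1 %% #|Omega| = enum_rank a.
Proof. by rewrite string_code_rcons addnS /= modnMDl modn_small. Qed.

Lemma string_code_inj (Omega : finType) : injective (@string_code Omega).
Proof.
move=> s; elim/last_ind: s => [|s a IHs]; elim/last_ind => [|s' a' _] //.
- by rewrite string_code_rcons addnS.
- by rewrite string_code_rcons addnS.
move=> E; have := code_prefix_rcons s a; have := code_last_rcons s a.
rewrite E code_prefix_rcons code_last_rcons => /ord_inj/enum_rank_inj ->.
by move=> /esym/IHs ->.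
Qed.

Lemma string_code_surj (Omega : alphabetType) c :
  exists s : seq Omega, string_code s = c.
Proof.
have K_gt0 : 0 < #|Omega| by apply/card_gt0P; exists point.
elim/ltn_ind: c => -[|c] IHc; first by exists [::].
have [s sE] := IHc (c %/ #|Omega|) (leq_ltn_trans (leq_div _ _) (ltnSn c)).
exists (rcons s (enum_val (Ordinal (ltn_pmod c K_gt0)))).
by rewrite string_code_rcons sE enum_valK /= addnS -divn_eq.
Qed.

Definition string_decode (Omega : alphabetType) c : seq Omega :=
  sval (cid (string_code_surj Omega c)).
Arguments string_decode : clear implicits.

Lemma string_decodeK (Omega : alphabetType) :
  cancel (string_decode Omega) (@string_code Omega).
Proof. by move=> c; rewrite /string_decode; case: cid. Qed.

Lemma string_codeK (Omega : alphabetType) :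
  cancel (@string_code Omega) (string_decode Omega).
Proof. by move=> s; apply: string_code_inj; rewrite string_decodeK. Qed.

Lemma code_take (Omega : finType) m (s : seq Omega) :
  string_code (take m s) =
  iter (size s - m) (code_prefix #|Omega|) (string_code s).
Proof.
elim/last_ind: s => [|s a IHs] /=; first by [].
rewrite size_rcons; case: (leqP m (size s)) => hm.
  by rewrite subSn// iterSr code_prefix_rcons -IHs -cats1 takel_cat.
by rewrite (eqP (_ : _ - m == 0)) ?subn_eq0// take_oversize// size_rcons.
Qed.

Lemma size_le_code (Omega : finType) (s : seq Omega) : size s <= string_code s.
Proof.
elim/last_ind: s => [|s a IHs] //; rewrite size_rcons string_code_rcons addnS ltnS.
rewrite (leq_trans IHs)// (leq_trans _ (leq_addr _ _))// leq_pmulr//.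
by apply/card_gt0P; exists a.
Qed.

Lemma iter_code_prefix0 K i : iter i (code_prefix K) 0 = 0.
Proof. by elim: i => //= i ->; rewrite /code_prefix div0n. Qed.

(** Stripping letters one by one reaches the code 0 after exactly [size s] steps, so the length
    counts the non-zero iterates. The slack in [M] lets the code itself serve as the bound. *)
Lemma size_from_code (Omega : finType) (s : seq Omega) M : size s <= M ->
  size s = \sum_(i < M) (0 < iter i (code_prefix #|Omega|) (string_code s) : nat).
Proof.
elim/last_ind: s M => [|s a IHs] M.
  move=> _; rewrite big1// => i _.
  by rewrite iter_code_prefix0.
rewrite size_rcons; case: M => // M; rewrite ltnS => /IHs {1}->.
rewrite big_ord_recl /= {1}string_code_rcons addnS add1n; congr _.+1.
by apply: eq_bigr => i _; rewrite -iterS iterSr code_prefix_rcons.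
Qed.

(** Letters are read off the code from the last to the first, hence the commutative [op]. The inner
    sum is a finite case distinction that selects the letter in question. *)
Lemma big_from_code (Omega : finType) idx (op : Monoid.com_law idx)
    (s : seq Omega) (G : Omega -> nat) :
  \big[op/idx]_(a <- s) G a = \big[op/idx]_(i < size s) \sum_a
    ((enum_rank a : nat) ==
      (iter i (code_prefix #|Omega|) (string_code s)).-1 %% #|Omega|) * G a.
Proof.
elim/last_ind: s => [|s a IHs]; first by rewrite big_nil big_ord0.
rewrite size_rcons big_ord_recl big_rcons /= Monoid.mulmC; congr (op _ _).
  rewrite code_last_rcons (bigD1 a)//= eqxx mul1n big1 ?addn0// => b ba.
  by case: eqP => // /ord_inj/enum_rank_inj E; rewrite E eqxx in ba.
rewrite IHs; apply: eq_bigr => i _; apply: eq_bigr => b _.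
by rewrite -iterS iterSr code_prefix_rcons.
Qed.

Lemma recursive_bigsum n (I : Type) (r : seq I) (G : I -> seq nat -> nat) :
  (forall i, recursive n (G i)) -> recursive n (fun e => \sum_(i <- r) G i e).
Proof.
move=> hG; elim: r => [|i r IHr].
  by apply: recursive_ext (recursive0 n) => e _; rewrite big_nil.
by apply: recursive_ext (recursive_add (hG i) IHr) => e _; rewrite big_cons.
Qed.

Lemma recursive_code_prefix n K f : recursive n f ->
  recursive n (fun e => code_prefix K (f e)).
Proof.
move=> hf; apply: recursive_div; last exact: recursive_const.
exact: recursive_pred.
Qed.

Lemma recursive_iter_code_prefix n K i f : recursive n i -> recursive n f ->
  recursive n (fun e => iter (i e) (code_prefix K) (f e)).
Proof.
move=> hi hf; apply: recursive_iter => //.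
by apply: recursive_code_prefix; apply: recursive_var.
Qed.

Lemma recursive_string_size (Omega : alphabetType) n f : recursive n f ->
  recursive n (fun e => size (string_decode Omega (f e))).
Proof.
move=> hf.
have h : recursive n (fun e =>
    \sum_(i < f e) (0 < iter i (code_prefix #|Omega|) (f e) : nat)).
  apply: (recursive_sum
    (G := fun i e => (0 < iter i (code_prefix #|Omega|) (f e) : nat))) => //.
  apply: (@recursive_leq _ (fun=> 1)); first exact: recursive_const.
  by apply: recursive_iter_code_prefix (recursive_weaken hf); apply: recursive_head.
apply: recursive_ext h => e _.
rewrite (@size_from_code _ (string_decode Omega (f e)) (f e)); last first.
  by rewrite -{2}(string_decodeK Omega (f e)) size_le_code.
by rewrite string_decodeK.
Qed.

Lemma recursive_string_take (Omega : alphabetType) n m f :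
  recursive n m -> recursive n f ->
  recursive n (fun e => string_code (take (m e) (string_decode Omega (f e)))).
Proof.
move=> hm hf; have h : recursive n (fun e =>
    iter (size (string_decode Omega (f e)) - m e) (code_prefix #|Omega|) (f e)).
  apply: recursive_iter_code_prefix => //; apply: recursive_sub => //.
  exact: recursive_string_size.
by apply: recursive_ext h => e _; rewrite code_take string_decodeK.
Qed.

Lemma recursive_letter (Omega : alphabetType) n (G : Omega -> seq nat -> nat) f :
  (forall a, recursive n (G a)) -> recursive n f ->
  recursive n.+1 (fun e => \sum_a ((enum_rank a : nat) ==
      (iter (head 0 e) (code_prefix #|Omega|) (f (behead e))).-1 %% #|Omega|) *
      G a (behead e)).
Proof.
move=> hG hf; apply: recursive_bigsum => a.
apply: recursive_mul; last exact: recursive_weaken.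
apply: (@recursive_eq _ (fun=> enum_rank a)); first exact: recursive_const.
apply: recursive_mod; last exact: recursive_const.
apply: recursive_pred; apply: recursive_iter_code_prefix (recursive_weaken hf).
exact: recursive_head.
Qed.

Lemma recursive_string_sum (Omega : alphabetType) n (G : Omega -> seq nat -> nat) f :
  (forall a, recursive n (G a)) -> recursive n f ->
  recursive n (fun e => \sum_(a <- string_decode Omega (f e)) G a e).
Proof.
move=> hG hf.
have := recursive_sum (G := fun i e => \sum_a ((enum_rank a : nat) ==
  (iter i (code_prefix #|Omega|) (f e)).-1 %% #|Omega|) * G a e)
  (recursive_string_size Omega hf) (recursive_letter hG hf).
by apply: recursive_ext => e _; rewrite [RHS]big_from_code string_decodeK.
Qed.

Lemma recursive_string_prod (Omega : alphabetType) n (G : Omega -> seq nat -> nat) f :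
  (forall a, recursive n (G a)) -> recursive n f ->
  recursive n (fun e => \prod_(a <- string_decode Omega (f e)) G a e).
Proof.
move=> hG hf.
have := recursive_prod (G := fun i e => \sum_a ((enum_rank a : nat) ==
  (iter i (code_prefix #|Omega|) (f e)).-1 %% #|Omega|) * G a e)
  (recursive_string_size Omega hf) (recursive_letter hG hf).
by apply: recursive_ext => e _; rewrite [RHS]big_from_code string_decodeK.
Qed.

(* The strings of length [N] are those whose codes lie in the interval of length
   [#|Omega| ^ N] starting at [first_code #|Omega| N]. *)
Definition first_code K N := \sum_(i < N) K ^ i.

Local Open Scope classical_set_scope.
Local Open Scope ring_scope.

(** * Expectations over strings of fixed length *)

(** Expectation over [N] independent letters of law [P], the last letter being integrated first.
    Arbitrary weights are allowed, so that the same operator evaluates dyadic lower approximations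
    of [P]. *)
Fixpoint expect (R : realType) (Omega : finType) (P : Omega -> R) N
    (F : seq Omega -> R) : R :=
  if N is N'.+1 then expect P N' (fun s => \sum_a P a * F (rcons s a))
  else F [::].

Lemma eq_expect (R : realType) (Omega : finType) (P : Omega -> R) N F G :
  (forall s, size s = N -> F s = G s) -> expect P N F = expect P N G.
Proof.
elim: N F G => [|N IHN] F G FG /=; first exact: FG.
apply: IHN => s sN; apply: eq_bigr => a _; congr (_ * _).
by apply: FG; rewrite size_rcons sN.
Qed.

(** This is independence of consecutive blocks, in the form used to condition on the past. *)
Lemma expect_cat (R : realType) (Omega : finType) (P : Omega -> R) m n F :
  expect P (m + n) F = expect P m (fun s => expect P n (fun s' => F (s ++ s'))).
Proof.
elim: n F => [|n IHn] F.
  by rewrite addn0; apply: eq_expect => s _ /=; rewrite cats0.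
rewrite addnS /= IHn; apply: eq_expect => s _ /=.
by apply: eq_expect => s' _; apply: eq_bigr => a _; rewrite rcons_cat.
Qed.

Lemma expectS (R : realType) (Omega : finType) (P : Omega -> R) n F :
  expect P n.+1 F = \sum_a P a * expect P n (fun s => F (a :: s)).
Proof. by rewrite -add1n expect_cat /=. Qed.

Lemma expectD (R : realType) (Omega : finType) (P : Omega -> R) N F G :
  expect P N (fun s => F s + G s) = expect P N F + expect P N G.
Proof.
elim: N F G => [|N IHN] F G //=; rewrite -IHN; apply: eq_expect => s _.
by rewrite -big_split/=; apply: eq_bigr => a _; rewrite mulrDr.
Qed.

Lemma expectZ (R : realType) (Omega : finType) (P : Omega -> R) N c F :
  expect P N (fun s => c * F s) = c * expect P N F.
Proof.
elim: N F => [|N IHN] F //=; rewrite -IHN; apply: eq_expect => s _.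
by rewrite mulr_sumr; apply: eq_bigr => a _; rewrite mulrCA.
Qed.

Lemma expect_prod (R : realType) (Omega : finType) (P : Omega -> R) N g :
  expect P N (fun s => \prod_(a <- s) g a) = (\sum_a P a * g a) ^+ N.
Proof.
elim: N => [|N IHN] /=; first by rewrite big_nil.
rewrite exprS -IHN -expectZ; apply: eq_expect => s _; rewrite mulr_suml.
by apply: eq_bigr => a _; rewrite big_rcons/= [_ * g a]mulrC mulrA.
Qed.

Lemma expect_le (R : realType) (Omega : finType) (P : Omega -> R) N F G :
  (forall a, 0 <= P a) -> (forall s, size s = N -> F s <= G s) ->
  expect P N F <= expect P N G.
Proof.
move=> P0; elim: N F G => [|N IHN] F G FG /=; first exact: FG.
apply: IHN => s sN; apply: ler_sum => a _; apply: ler_wpM2l => //.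
by apply: FG; rewrite size_rcons sN.
Qed.

Lemma expect_ge0 (R : realType) (Omega : finType) (P : Omega -> R) N F :
  (forall a, 0 <= P a) -> (forall s, 0 <= F s) -> 0 <= expect P N F.
Proof.
move=> P0; elim: N F => [|N IHN] F F0 //=; apply: IHN => s.
by apply: sumr_ge0 => a _; apply: mulr_ge0.
Qed.

Lemma expect_cst (R : realType) (Omega : finType) (P : Omega -> R) N c :
  finite_prob_space P -> expect P N (fun=> c) = c.
Proof.
move=> [_ P1]; elim: N => [|N IHN] //=; rewrite -[RHS]IHN.
by apply: eq_expect => s _; rewrite -mulr_suml P1 mul1r.
Qed.

Lemma expect_take (R : realType) (Omega : finType) (P : Omega -> R) m n F :
  finite_prob_space P -> (m <= n)%N ->
  expect P n (fun s => F (take m s)) = expect P m F.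
Proof.
move=> hP /subnKC <-; rewrite expect_cat; apply: eq_expect => s sm.
rewrite -[RHS](expect_cst (n - m) (F s) hP); apply: eq_expect => s' _.
by rewrite -{1}sm take_size_cat.
Qed.

Lemma sum_ord_mul (V : nmodType) m K (G : nat -> V) :
  \sum_(i < (m * K)%N) G i = \sum_(i < m) \sum_(r < K) G (i * K + r)%N.
Proof.
elim: m => [|m IHm]; first by rewrite !big_ord0.
by rewrite mulSnr big_split_ord big_ord_recr/= -IHm.
Qed.

Lemma expect_codes (R : realType) (Omega : alphabetType) (P : Omega -> R) N F :
  expect P N F = \sum_(i < (#|Omega| ^ N)%N)
    let s := string_decode Omega (first_code #|Omega| N + i) in
    (\prod_(a <- s) P a) * F s.
Proof.
elim: N F => [|N IHN] F.
  rewrite expn0 big_ord1 /first_code big_ord0 /=.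
  by rewrite (string_codeK [::]) big_nil mul1r.
rewrite /= IHN expnSr.
(* The interval for length [N.+1] starts at the first extension of the first string of length [N],
   so it splits into consecutive groups of [#|Omega|] codes, one group per prefix. *)
have -> : first_code #|Omega| N.+1 = (first_code #|Omega| N * #|Omega| + 1)%N.
  rewrite /first_code big_ord_recl/= expn0 addnC big_distrl/=; congr (_ + _)%N.
  by apply: eq_bigr => i _; rewrite expnSr.
rewrite (sum_ord_mul _ _ (fun i => let s := string_decode Omega
  (first_code #|Omega| N * #|Omega| + 1 + i) in
  (\prod_(a <- s) P a) * F s)).
apply: eq_bigr => i _ /=; rewrite mulr_sumr.
rewrite (reindex (@enum_rank Omega))/=; last first.
  by apply: onW_bij; exists (@enum_val _ _); [exact: enum_rankK | exact: enum_valK].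
apply: eq_bigr => a _.
have -> : (first_code #|Omega| N * #|Omega| + 1 + (i * #|Omega| + enum_rank a))%N =
    string_code (rcons (string_decode Omega (first_code #|Omega| N + i)) a).
  by rewrite string_code_rcons string_decodeK mulnDl addn1 addSn !addnS addnA.
by rewrite string_codeK big_rcons /= mulrA.
Qed.

Lemma expect_scale (R : realType) (Omega : finType) (P : Omega -> R) c N F :
  expect (fun a => c * P a) N F = c ^+ N * expect P N F.
Proof.
elim: N F => [|N IHN] F; first by rewrite expr0 mul1r.
rewrite /= IHN exprSr -[RHS]mulrA -[X in _ = _ * X]expectZ.
congr (_ * _); apply: eq_expect => s _; rewrite mulr_sumr.
by apply: eq_bigr => a _; rewrite mulrA.
Qed.

Lemma expect_le_weights (R : realType) (Omega : finType) (P P' : Omega -> R) N F :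
  (forall a, 0 <= P' a <= P a) -> (forall s, 0 <= F s) ->
  expect P' N F <= expect P N F.
Proof.
move=> P'P; elim: N F => [|N IHN] F F0 //=.
have P'0 a : 0 <= P' a by case/andP: (P'P a).
apply: (@le_trans _ _ (expect P' N (fun s => \sum_a P a * F (rcons s a)))).
  apply: expect_le => // s _; apply: ler_sum => a _; apply: ler_wpM2r => //.
  by case/andP: (P'P a).
apply: IHN => s; apply: sumr_ge0 => a _; apply: mulr_ge0 => //.
by case/andP: (P'P a) => h1; apply: le_trans.
Qed.

(** Replacing [P] by [P'] one letter at a time costs at most [#|Omega| * d] per letter, since [F] is
    at most 1. Approximating from below keeps the total mass of [P'] at most 1, so errors add up
    without being amplified. *)
Lemma expect_approx (R : realType) (Omega : finType) (P P' : Omega -> R) d N F :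
  finite_prob_space P -> (forall a, 0 <= P' a <= P a) ->
  (forall a, P a - P' a <= d) -> (forall s, 0 <= F s <= 1) ->
  0 <= expect P N F - expect P' N F <= N%:R * (#|Omega|%:R * d).
Proof.
move=> hP P'P Pd; elim: N F => [|N IHN] F F01 /=.
  by rewrite subrr mul0r lexx.
set G := fun s => \sum_a P a * F (rcons s a).
set G' := fun s => \sum_a P' a * F (rcons s a).
have P'0 a : 0 <= P' a by case/andP: (P'P a).
have /andP[h1 h2] : 0 <= expect P N G - expect P' N G <= N%:R * (#|Omega|%:R * d).
  apply: IHN => s; apply/andP; split.
    by apply: sumr_ge0 => a _; apply: mulr_ge0; [case: hP|case/andP: (F01 (rcons s a))].
  case: (hP) => P0 <-; apply: ler_sum => a _; rewrite ler_piMr//.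
  by case/andP: (F01 (rcons s a)).
(* The difference splits into [expect P N G - expect P' N G], bounded by induction, and this term,
   which is the error made at the last letter. *)
have E : expect P' N (fun s => G s - G' s) = expect P' N G - expect P' N G'.
  by rewrite expectD -mulN1r -expectZ; congr (_ + _); apply: eq_expect => s _; rewrite mulN1r.
have d0 : 0 <= #|Omega|%:R * d.
  have -> : #|Omega|%:R * d = \sum_(a : Omega) d by rewrite sumr_const mulr_natl.
  apply: sumr_ge0 => a _; apply: le_trans (Pd a).
  by rewrite subr_ge0; case/andP: (P'P a).
have h3 : 0 <= expect P' N (fun s => G s - G' s) <= #|Omega|%:R * d.
  have hG s : 0 <= G s - G' s <= #|Omega|%:R * d.
    rewrite -sumrB; apply/andP; split.
      apply: sumr_ge0 => a _; rewrite -mulrBl mulr_ge0//.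
        by rewrite subr_ge0; case/andP: (P'P a).
      by case/andP: (F01 (rcons s a)).
    have -> : #|Omega|%:R * d = \sum_(a : Omega) d by rewrite sumr_const mulr_natl.
    apply: ler_sum => a _; rewrite -mulrBl (le_trans _ (Pd a))// ler_piMr//.
      by rewrite subr_ge0; case/andP: (P'P a).
    by case/andP: (F01 (rcons s a)).
  rewrite expect_ge0//=; last by move=> s; case/andP: (hG s).
  apply: (@le_trans _ _ (expect P' N (fun=> #|Omega|%:R * d))).
    by apply: expect_le => // s _; case/andP: (hG s).
  by rewrite -[leRHS](expect_cst N _ hP); apply: expect_le_weights.
rewrite -natr1 mulrDl mul1r; move: h3; rewrite E => /andP[h3 h4].
by apply/andP; split; lra.
Qed.

(** * The Bernoulli measure of open sets *)

Lemma measurable_open_of (Omega : pointedType) (S : set (seq Omega)) :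
  measurable (open_of S : set (seq_space Omega)).
Proof. by apply: sub_sigma_algebra; exists S. Qed.

(** The measure is prescribed on cylinders only. The proof is by induction on the number of letters
    still free: a cylinder is the finite disjoint union of its one-letter extensions. *)
Lemma measure_prefix_event (R : realType) (Omega : alphabetType)
    (P : Omega -> R) (lam : probability (seq_space Omega) R) N (Q : pred (seq Omega)) :
  is_bernoulli_measure P lam ->
  lam [set alpha | Q (mkseq alpha N)] = (expect P N (fun s => (Q s)%:R))%:E.
Proof.
move=> hlam.
pose A s n := [set alpha : nat -> Omega | mkseq alpha (size s) = s /\
                       Q (mkseq alpha (size s + n))].
have mA s n : measurable (A s n : set (seq_space Omega)).
  have -> : A s n = open_of [set s] `&`
      open_of [set u | size u = (size s + n)%N /\ Q u].
    apply/seteqP; split=> alpha [h1 h2]; split.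
    - by exists (size s); rewrite /= h1.
    - by exists (size s + n)%N; rewrite /= size_mkseq.
    - by case: h1 => k /= <-; rewrite size_mkseq.
    - by case: h2 => k /= [<-]; rewrite !size_mkseq.
  by apply: measurableI; apply: measurable_open_of.
suff H n s : lam (A s n) =
    ((\prod_(a <- s) P a) * expect P n (fun s' => (Q (s ++ s'))%:R))%:E.
  have := H N [::]; rewrite big_nil mul1r /= => <-.
  by congr (lam _); apply/seteqP; split=> alpha /=; [|case].
elim: n s => [|n IHn] s.
  have [Qs|Qs] := boolP (Q s); rewrite /= cats0.
    rewrite Qs mulr1 -hlam; congr (lam _); apply/seteqP; split=> alpha.
      by move=> [h _]; exists (size s).
    by move=> [k /= sE]; rewrite /A /= -sE size_mkseq addn0 sE.
  rewrite (negbTE Qs) mulr0 (_ : A s 0%N = set0) ?measure0//.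
  rewrite -subset0 => alpha [h1]; rewrite addn0 h1 => Qs'.
  by rewrite Qs' in Qs.
have -> : A s n.+1 = \bigcup_(a in setT) A (rcons s a) n.
  apply/seteqP; split => alpha.
    move=> [h1 h2]; exists (alpha (size s)) => //.
    by rewrite /A /= size_rcons addSnnS; split => //; rewrite mkseqS h1.
  move=> [a _ []]; rewrite size_rcons addSnnS mkseqS => /rcons_inj[h1 h2] h3.
  by split.
rewrite expectS measure_fin_bigcup//.
- rewrite (fsbig_fwiden (index_enum Omega))/= ?index_enum_uniq//; last 2 first.
  + by move=> a _; rewrite /= mem_index_enum.
  + by move=> a [_ /= []].
  rewrite mulr_sumr -sumEFin.
  apply: eq_bigr => a _; rewrite IHn big_rcons/= mulrA.
  by congr (_ * _)%:E; apply: eq_expect => s' _; rewrite cat_rcons.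
- exact: finite_finset.
- move=> a b _ _ [alpha []]; rewrite /A /= !size_rcons => -[h1 _] [].
  by rewrite h1 => /rcons_inj[].
Qed.

(** Finite-horizon version of [open_of]: the events at horizon [N] depend on [N] letters and
    increase to the open set. *)
Definition has_prefix (Omega : Type) (chi : pred (seq Omega)) N : pred (seq Omega) :=
  fun s => has (fun m => chi (take m s)) (iota 0 N.+1).

Lemma has_prefixP (Omega : Type) (chi : pred (seq Omega)) N (alpha : nat -> Omega) :
  has_prefix chi N (mkseq alpha N) <-> exists2 m, (m <= N)%N & chi (mkseq alpha m).
Proof.
have tk m : (m <= N)%N -> take m (mkseq alpha N) = mkseq alpha m.
  by move=> mN; rewrite -map_take take_iota (minn_idPl mN).
split=> [/hasP[m]|[m mN h]].
  by rewrite mem_iota ltnS => mN; rewrite tk//; exists m.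
by apply/hasP; exists m; rewrite ?tk// mem_iota ltnS.
Qed.

Lemma open_of_has_prefix (Omega : Type) (chi : pred (seq Omega)) :
  open_of [set s | chi s] =
  \bigcup_N [set alpha | has_prefix chi N (mkseq alpha N)].
Proof.
apply/seteqP; split=> alpha.
  by move=> [m hm]; exists m => //=; apply/has_prefixP; exists m.
by move=> [N _ /has_prefixP[m _ hm]]; exists m.
Qed.

Lemma measurable_prefix_event (Omega : pointedType) (Q : pred (seq Omega)) N :
  measurable ([set alpha | Q (mkseq alpha N)] : set (seq_space Omega)).
Proof.
have -> : [set alpha | Q (mkseq alpha N)] = open_of [set s | size s = N /\ Q s].
  apply/seteqP; split=> alpha; first by move=> h; exists N; rewrite /= size_mkseq.
  by move=> [n /= [<-]]; rewrite size_mkseq.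
exact: measurable_open_of.
Qed.

Section measure_open.
Context (R : realType) (Omega : alphabetType) (P : Omega -> R)
  (lam : probability (seq_space Omega) R) (hlam : is_bernoulli_measure P lam)
  (chi : pred (seq Omega)).

Lemma measure_open_ge N :
  ((expect P N (fun s => (has_prefix chi N s)%:R))%:E <=
    lam (open_of [set s | chi s]))%E.
Proof.
rewrite -(measure_prefix_event N (has_prefix chi N) hlam); apply: le_measure.
- by rewrite inE; apply: measurable_prefix_event.
- by rewrite inE; apply: measurable_open_of.
- by rewrite open_of_has_prefix; apply: (bigcup_sup (i := N)).
Qed.

(** Continuity of the measure from below along the finite horizons. *)
Lemma measure_open_le (b : R) :
  (forall N, expect P N (fun s => (has_prefix chi N s)%:R) <= b) ->
  (lam (open_of [set s | chi s]) <= b%:E)%E.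
Proof.
move=> hb; rewrite open_of_has_prefix.
pose U N : set (seq_space Omega) := [set alpha | has_prefix chi N (mkseq alpha N)].
have hU : lam \o U @ \oo --> lam (\bigcup_N U N).
  apply: nondecreasing_cvg_mu.
  - by move=> N; apply: measurable_prefix_event.
  - by apply: bigcup_measurable => N _; apply: measurable_prefix_event.
  - move=> N M NM; apply/subsetPset => alpha /has_prefixP[m mN hm].
    by apply/has_prefixP; exists m => //; apply: leq_trans NM.
rewrite -(cvg_lim _ hU)//; apply: lime_le.
  by apply/cvg_ex; exists (lam (\bigcup_N U N)).
by apply: nearW => N /=; rewrite (measure_prefix_event N _ hlam) lee_fin.
Qed.
End measure_open.

(** * Decidable Schnorr tests *)

(** A decidable set is the domain of an unbounded search whose test ignores the search variable: the
    search stops at 0 on members and diverges elsewhere. *)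
Lemma re_set_recursive (Omega : alphabetType) (chi : nat -> pred (seq Omega)) :
  recursive 2 (fun e => chi (nth 0 e 0) (string_decode Omega (nth 0 e 1)))%N ->
  re_set [set ns | (0 < ns.1)%N && chi ns.1 ns.2].
Proof.
move=> hchi; split=> [n s /= /andP[]//|].
have [p hp] : recursive 3 (fun e => ~~ chi (nth 0 e 1) (string_decode Omega (nth 0 e 2)))%N.
  apply: recursive_neg.
  apply: recursive_ext (recursive_weaken hchi) => e _.
  by rewrite !nth_behead.
exists (RMin p) => n s n0 /=; rewrite n0/=; split=> [h|[y [/hp + _]]].
  by exists 0%N; split=> //; apply/hp; rewrite /= string_codeK h.
by rewrite /= string_codeK; case: (chi n s).
Qed.

Lemma recursive_tuple1 (f : 1.-tuple nat -> nat) :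
  total_recursive f -> recursive 1 (fun e => f [tuple nth 0%N e 0]).
Proof.
move=> [p hp]; exists p => v y; rewrite hp; suff -> : [tuple nth 0%N v 0] = v by [].
by case/tupleP: v => x v; apply: val_inj; rewrite /= tuple0.
Qed.

(** Provides the lower approximations that [expect_approx] requires. The gap 3 covers the error of
    the given approximation, the floor and the decrement, one unit each. *)
Lemma computable_real_dyadic (R : realType) (x : R) :
  0 <= x -> computable_real x ->
  exists p : nat -> nat, recursive 1 (fun e => p (nth 0%N e 0)) /\
    forall k, (p k)%:R <= 2 ^+ k * x <= (p k)%:R + 3.
Proof.
move=> x0 [f [[a [b [c [ha hb hc fE]]]] fx]].
(* The final decrement turns the approximation into a lower bound. *)
exists (fun k => (2 ^ k * (a [tuple k] - b [tuple k])) %/ (c [tuple k]).+1 - 1)%N.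
split.
  apply: recursive_sub; last exact: recursive_const.
  apply: recursive_div; last exact/recursive_succ/recursive_tuple1.
  apply: recursive_mul; last by apply: recursive_sub; apply: recursive_tuple1.
  by apply: (@recursive_exp _ (fun=> 2%N)); [exact: recursive_const | exact: recursive_var].
move=> k; have := fx k; rewrite fE.
set A := a _; set B := b _; set C := c _.
rewrite fmorph_div rmorphB/= !ratr_nat.
set y := _ / _; set q := (_ %/ _)%N => xy.
have hk : 0 < 2 ^+ k :> R by rewrite exprn_gt0.
have {}xy : `|2 ^+ k * x - 2 ^+ k * y| < 1.
  rewrite -mulrBr normrM gtr0_norm//.
  by rewrite mulrC -ltr_pdivlMr// div1r.
(* Truncated subtraction in the numerator turns a negative approximation into 0, so [q] is the floor
   of the positive part. *)
have hq : q%:R <= Num.max 0 (2 ^+ k * y) < q%:R + 1.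
  have C0 : (0 : R) < C.+1%:R by rewrite ltr0n.
  have -> : Num.max 0 (2 ^+ k * y) = (2 ^ k * (A - B))%N%:R / C.+1%:R.
    rewrite natrM natrX; case: (leqP A B) => AB.
      rewrite (eqP (_ : (A - B)%N == 0%N)) ?subn_eq0// mulr0 mul0r.
      apply/max_idPl; rewrite pmulr_rle0// /y pmulr_lle0 ?invr_gt0//.
      by rewrite subr_le0 ler_nat.
    rewrite natrB 1?ltnW// -mulrA; apply/max_idPr; rewrite mulr_ge0 ?ltW//.
    by rewrite divr_gt0// subr_gt0 ltr_nat.
  rewrite ler_pdivlMr// ltr_pdivrMr// -natrM ler_nat natr1 -natrM ltr_nat.
  by rewrite leq_trunc_div/= ltn_ceil.
have hkx : 0 <= 2 ^+ k * x by rewrite mulr_ge0// ltW.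
move: hq xy; move: (2 ^+ k * x) hkx (2 ^+ k * y) => X X0 Y hq.
rewrite ltr_distl => /andP[h1 h2]; move: hq.
case: q => [|q]; rewrite ?sub0n ?subn1 ?mulr0n /=.
  by rewrite maxEle; case: (leP 0 Y) => hY /andP[h3 h4]; apply/andP; split; lra.
rewrite -natr1; have := ler0n R q.
by rewrite maxEle; case: (leP 0 Y) => hY q0 /andP[h3 h4]; apply/andP; split; lra.
Qed.

Lemma recursive_behead_var n i : (i.+1 < n)%N ->
  recursive n (fun e => nth 0%N (behead e) i).
Proof.
by move=> hi; apply: recursive_ext (recursive_var hi) => e _; rewrite nth_behead.
Qed.

Lemma recursive_has_prefix (Omega : alphabetType) (chi : nat -> pred (seq Omega))
    n f N c :
  recursive 2 (fun e => chi (nth 0 e 0) (string_decode Omega (nth 0 e 1)))%N ->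
  recursive n f -> recursive n N -> recursive n c ->
  recursive n (fun e => has_prefix (chi (f e)) (N e) (string_decode Omega (c e))).
Proof.
move=> hchi hf hN hc.
apply: (recursive_has
  (G := fun m e => chi (f e) (take m (string_decode Omega (c e))))).
  exact: recursive_succ.
have := recursive_app2 (F := fun x y => chi x (string_decode Omega y)) hchi
  (recursive_weaken hf)
  (recursive_string_take Omega (recursive_head n) (recursive_weaken hc)).
by apply: recursive_ext => e _; rewrite string_codeK.
Qed.

(** Reduces a Schnorr test to bounds on finite expectations. Beyond the recursive horizon [Nf n j]
    the event gains at most [2 ^- j.+1], so its measure is computed from strings of that length. The
    bound [2 ^- n.+1] leaves room for the strict inequality of a test, since limits preserve only
    weak ones. *)
Lemma schnorr_test_criterion (R : realType) (Omega : alphabetType) (P : Omega -> R)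
    (lam : probability (seq_space Omega) R) (chi : nat -> pred (seq Omega))
    (Nf : nat -> nat -> nat) :
  computable_prob_space P -> is_bernoulli_measure P lam ->
  recursive 2 (fun e => chi (nth 0 e 0) (string_decode Omega (nth 0 e 1)))%N ->
  recursive 2 (fun e => Nf (nth 0 e 0) (nth 0 e 1))%N ->
  (forall n N, (0 < n)%N ->
    expect P N (fun s => (has_prefix (chi n) N s)%:R) <= 2 ^- n.+1) ->
  (forall n j N, (0 < n)%N ->
    expect P N (fun s => (has_prefix (chi n) N s)%:R) <=
    expect P (Nf n j) (fun s => (has_prefix (chi n) (Nf n j) s)%:R) + 2 ^- j.+1) ->
  schnorr_test lam [set ns | (0 < ns.1)%N && chi ns.1 ns.2].
Proof.
move=> [hP cP] hlam hchi hNf small approx.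
set C := [set _ | _].
have CE n : (0 < n)%N -> section C n = [set s | chi n s].
  by move=> n0; apply/seteqP; split=> s; rewrite /section /C /= n0.
split; first split.
- exact: re_set_recursive.
- move=> n n0; rewrite CE//.
  apply: (@le_lt_trans _ _ (2 ^- n.+1)%:E).
    by apply: (measure_open_le hlam) => N; apply: small.
  by rewrite lte_fin ltf_pV2 ?posrE ?exprn_gt0// ltr_eXn2l// ltr1n.
have /choice[p hp] (a : Omega) : exists p : nat -> nat,
    recursive 1 (fun e => p (nth 0%N e 0)) /\
    forall k, (p k)%:R <= 2 ^+ k * P a <= (p k)%:R + 3.
  by apply: computable_real_dyadic => //; case: hP.
pose K := #|Omega|.
(* The rounding error is at most [Nf n j * K * 3 / 2 ^ prec n j]. The summands [Nf n j + 3 * K]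
   outweigh the numerator, and [j.+1] leaves an error below [2 ^- j.+1]. *)
pose prec n j := (j.+1 + Nf n j + 3 * K)%N.
pose word n j i := string_decode Omega (first_code K (Nf n j) + i).
pose num n j := (\sum_(i < K ^ Nf n j) (\prod_(a <- word n j i) p a (prec n j)) *
  has_prefix (chi n) (Nf n j) (word n j i))%N.
(* The common denominator has one factor [2 ^ prec n j] per letter; a coded rational stores its
   denominator minus one. *)
exists (fun v => let n := nth 0%N v 0 in let j := nth 0%N v 1 in
  ((num n j)%:R - 0%:R) / ((2 ^ (prec n j * Nf n j)).-1).+1%:R).
have rprec : recursive 2 (fun e => prec (nth 0 e 0) (nth 0 e 1))%N.
  apply: recursive_add; last exact: recursive_const.
  by apply: recursive_add => //; apply: recursive_succ; apply: recursive_var.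
split.
  exists (fun v => num (nth 0 v 0) (nth 0 v 1))%N, (fun=> 0%N),
    (fun v => (2 ^ (prec (nth 0 v 0) (nth 0 v 1) * Nf (nth 0 v 0) (nth 0 v 1))).-1)%N.
  split=> //; last 2 first.
  - exact: (recursive_const 2 0).
  - exact: (recursive_pred (recursive_exp (recursive_const 2 2)
      (recursive_mul rprec hNf))).
  apply: (@recursive_sum 2 (fun e => K ^ Nf (nth 0 e 0) (nth 0 e 1))%N
    (fun i e => ((\prod_(a <- word (nth 0 e 0) (nth 0 e 1) i)
      p a (prec (nth 0 e 0) (nth 0 e 1))) * has_prefix (chi (nth 0 e 0))
        (Nf (nth 0 e 0) (nth 0 e 1)) (word (nth 0 e 0) (nth 0 e 1) i))%N)).
    by apply: (@recursive_exp _ (fun=> K)) => //; apply: recursive_const.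
  have rword : recursive 3 (fun e => first_code K (Nf (nth 0 (behead e) 0)
      (nth 0 (behead e) 1)) + head 0 e)%N.
    apply: recursive_add; last exact: recursive_head.
    apply: (recursive_sum (G := fun i _ => K ^ i)%N); first exact: (recursive_weaken hNf).
    by apply: (@recursive_exp _ (fun=> K)); [exact: recursive_const | exact: recursive_head].
  apply: recursive_mul.
    apply: (recursive_string_prod
      (G := fun a e => p a (prec (nth 0 (behead e) 0) (nth 0 (behead e) 1)))%N) => // a.
    by case: (hp a) => hpa _; apply: (recursive_app1 hpa (recursive_weaken rprec)).
  apply: (recursive_has_prefix hchi) => //; first exact: recursive_behead_var.
  exact: (recursive_weaken hNf).
move=> n j n0; rewrite /= CE//.
have -> : ratr (((num n j)%:R - 0%:R) / (2 ^ (prec n j * Nf n j)).-1.+1%:R) =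
   expect (fun a => 2 ^- prec n j * (p a (prec n j))%:R) (Nf n j)
     (fun s => (has_prefix (chi n) (Nf n j) s)%:R) :> R.
  rewrite subr0 fmorph_div/= !ratr_nat prednK ?expn_gt0// mulrC.
  rewrite expect_scale expect_codes natrX exprM exprVn; congr (_ * _).
  rewrite natr_sum; apply: eq_bigr => i _ /=.
  by rewrite natrM natr_prod.
set u := expect _ _ _.
have hu : 0 <= expect P (Nf n j) (fun s => (has_prefix (chi n) (Nf n j) s)%:R) - u
    < 2 ^- j.+1.
  have k0 : (0 : R) < 2 ^+ prec n j by rewrite exprn_gt0.
  suff /andP[-> h] : 0 <= expect P (Nf n j) (fun s => (has_prefix (chi n) (Nf n j) s)%:R) - u
      <= (Nf n j)%:R * (K%:R * (3 * 2 ^- prec n j)).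
    have hnat : (Nf n j * K * 3 < 2 ^ (Nf n j + 3 * K))%N.
      rewrite expnD -mulnA; apply: ltn_mul; first exact: ltn_expl.
      by rewrite mulnC; apply: ltn_expl.
    apply: (le_lt_trans h); rewrite mulrA mulrA -natrM -natrM ltr_pdivrMr//.
    rewrite /prec -addnA exprD mulKf ?gt_eqF ?exprn_gt0//.
    by rewrite -(natrX R 2) ltr_nat.
  apply: expect_approx => //.
  - move=> a; have [_ /(_ (prec n j)) /andP[h _]] := hp a.
    by rewrite mulr_ge0 ?invr_ge0 ?(ltW k0)//= mulrC ler_pdivrMr// mulrC.
  - move=> a; have [_ /(_ (prec n j)) /andP[_ h]] := hp a.
    have k1 : 2 ^+ prec n j != 0 :> R by rewrite gt_eqF.
    by rewrite -(ler_pM2l k0) mulrBr mulVKf// [leRHS]mulrCA divff// mulr1; lra.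
  - by move=> s; rewrite ler0n lern1 leq_b1.
have h1 := measure_open_ge hlam (chi n) (Nf n j).
have h2 := measure_open_le hlam (fun N => approx n j N n0).
move: h1 h2; case: (lam _) => [x| |]//=; rewrite !lee_fin => h1 h2.
(* Half of the tolerance pays for stopping at length [Nf n j], the other half for rounding the
   weights. *)
have E : 2 ^- j = 2 ^- j.+1 + 2 ^- j.+1 :> R.
  by rewrite [in RHS]exprS invfM; lra.
by case/andP: hu => h3 h4; rewrite ltr_norml E; apply/andP; split; lra.
Qed.

(** * Moments and anticoncentration of sums *)

(** From [1 - x <= expR (- x)] one gets [expR x <= (1 - x)^-1]. After multiplying out, the claim
    reads [0 <= x ^+ 2 * (1 - 2 * x)]. *)
Lemma expR_le_quadratic (R : realType) (x : R) :
  `|x| <= 2^-1 -> expR x <= 1 + x + 2 * x ^+ 2.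
Proof.
rewrite ler_norml => /andP[h1 h2].
have h3 : 1 - x <= expR (- x) by apply: expR_ge1Dx.
have h4 : 0 < 1 - x by lra.
rewrite -[x in expR x]opprK expRN (le_trans (y := (1 - x)^-1))//.
  by rewrite lef_pV2// posrE// (lt_le_trans h4).
rewrite -[leLHS]mul1r ler_pdivrMr//.
by have := sqr_ge0 x; nra.
Qed.

(** Take the [n]-th power of [x <= n%:R * expR (x / n%:R)]. *)
Lemma exprn_le_expR (R : realType) (x : R) n : (0 < n)%N -> 0 <= x ->
  x ^+ n <= n%:R ^+ n * expR x.
Proof.
move=> n0 x0; have n0' : 0 < n%:R :> R by rewrite ltr0n.
have -> : expR x = expR (x / n%:R) ^+ n.
  by rewrite -expRM_natr -mulrA mulVf ?mulr1// gt_eqF.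
rewrite -exprMn lerXn2r// ?nnegrE ?mulr_ge0 ?expR_ge0// ?ltW//.
have := expR_ge1Dx (x / n%:R); rewrite -(ler_pM2l n0') mulrDr mulrCA divff ?gt_eqF// !mulr1.
by apply: lt_le_trans; rewrite ltrDr.
Qed.

Lemma exprn_even_le_expR (R : realType) (x : R) r : (0 < r)%N ->
  x ^+ r.*2 <= r.*2%:R ^+ r.*2 * (expR x + expR (- x)).
Proof.
move=> r0; have r20 : (0 < r.*2)%N by rewrite double_gt0.
have e0 y : 0 <= r.*2%:R ^+ r.*2 * expR y :> R by rewrite mulr_ge0 ?expR_ge0.
rewrite mulrDr; case: (leP 0 x) => x0.
  by rewrite (le_trans (exprn_le_expR r20 x0))// lerDl.
have : x ^+ r.*2 = (- x) ^+ r.*2 by rewrite -!mul2n !exprM sqrrN.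
have x0' : 0 <= - x by rewrite oppr_ge0 ltW.
by move=> ->; rewrite (le_trans (exprn_le_expR r20 x0'))// lerDr.
Qed.

Section moments.
Context (R : realType) (Omega : finType) (P : Omega -> R)
  (hP : finite_prob_space P) (Y : Omega -> R) (B : R) (hB : 0 < B)
  (hY : forall a, `|Y a| <= B) (hm : rv_mean P Y = 0).

Let P0 : forall a, 0 <= P a. Proof. by case: hP. Qed.
Let P1 : \sum_a P a = 1. Proof. by case: hP. Qed.

(** Independence factors the exponential moment over the letters. In each factor the linear term of
    the quadratic bound vanishes because [Y] is centered. *)
Lemma expect_expR_sum N c : `|c| * B <= 2^-1 ->
  expect P N (fun s => expR (c * \sum_(a <- s) Y a)) <=
  expR (2 * (c * B) ^+ 2 * N%:R).
Proof.
move=> cB.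
have -> : expect P N (fun s => expR (c * \sum_(a <- s) Y a)) =
    (\sum_a P a * expR (c * Y a)) ^+ N.
  rewrite -expect_prod; apply: eq_expect => s _.
  by rewrite mulr_sumr expR_sum.
rewrite expRM_natr lerXn2r// ?nnegrE ?expR_ge0//.
  by apply: sumr_ge0 => a _; rewrite mulr_ge0 ?expR_ge0.
apply: le_trans (expR_ge1Dx _).
apply: (@le_trans _ _ (\sum_a (P a + c * (Y a * P a) + 2 * (c * B) ^+ 2 * P a))).
  apply: ler_sum => a _.
  have hcY : `|c * Y a| <= `|c| * B by rewrite normrM ler_wpM2l.
  have -> : P a + c * (Y a * P a) + 2 * (c * B) ^+ 2 * P a =
      P a * (1 + c * Y a + 2 * (c * B) ^+ 2) by ring.
  apply: ler_wpM2l => //; apply: le_trans (expR_le_quadratic (le_trans hcY cB)) _.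
  rewrite lerD2l ler_pM2l// -[leLHS]real_normK ?num_real// -[leRHS]real_normK ?num_real//.
  by rewrite lerXn2r ?nnegrE// (normrM c B) (gtr0_norm hB).
rewrite !big_split/= -!mulr_sumr P1.
have -> : \sum_a Y a * P a = 0 by exact: hm.
by rewrite mulr0 addr0 mulr1.
Qed.

Lemma even_moment r : (0 < r)%N -> exists2 C, 0 < C & forall k, (0 < k)%N ->
  expect P k (fun s => (\sum_(a <- s) Y a) ^+ r.*2) <= C * k%:R ^+ r.
Proof.
move=> r0; exists ((4 * B ^+ 2) ^+ r * (r.*2%:R ^+ r.*2 * (2 * expR 2^-1))).
  by rewrite !mulr_gt0 ?expR_gt0 ?exprn_gt0 ?mulr_gt0 ?ltr0n ?double_gt0 ?exprn_gt0.
move=> k k0; have k0' : 0 < k%:R :> R by rewrite ltr0n.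
(* This scale gives [c * B <= 1/2] and [2 * (c * B) ^+ 2 * k%:R = 1/2], so both exponential moments
   of [c] times the sum are bounded independently of [k]. *)
pose c := (2 * B * Num.sqrt k%:R)^-1.
have sk0 : 0 < Num.sqrt (k%:R : R) by rewrite sqrtr_gt0.
have c0 : 0 < c by rewrite invr_gt0 !mulr_gt0.
have c2 : c ^+ 2 = (4 * B ^+ 2 * k%:R)^-1.
  by rewrite /c exprVn !exprMn sqr_sqrtr ?ltW// -natrX.
have cB : c * B <= 2^-1.
  rewrite /c [2 * B]mulrC -mulrA invfM mulrAC mulVf ?gt_eqF// mul1r.
  rewrite lef_pV2 ?posrE ?mulr_gt0// ler_peMr//.
  by rewrite -[leLHS]sqrtr1 ler_sqrt// ler1n.
have cBk : 2 * (c * B) ^+ 2 * k%:R = 2^-1.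
  rewrite exprMn c2; field.
  by rewrite !gt_eqF.
have bound (e : bool) :
    expect P k (fun s => expR ((-1) ^+ e * c * \sum_(a <- s) Y a)) <= expR 2^-1.
  have := @expect_expR_sum k ((-1) ^+ e * c).
  rewrite normrM normr_sign mul1r (gtr0_norm c0) => /(_ cB) /le_trans; apply.
  suff -> : ((-1) ^+ e * c * B) ^+ 2 = (c * B) ^+ 2 by rewrite cBk.
  by rewrite -mulrA exprMn sqrr_sign mul1r.
apply: (@le_trans _ _ (expect P k (fun s => (4 * B ^+ 2 * k%:R) ^+ r *
   (r.*2%:R ^+ r.*2 * (expR ((-1) ^+ false * c * \sum_(a <- s) Y a) +
     expR ((-1) ^+ true * c * \sum_(a <- s) Y a)))))).
  apply: expect_le => // s _; set S := \sum_(a <- s) Y a.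
  rewrite expr0 mul1r expr1 mulN1r mulNr.
  have := exprn_even_le_expR (c * S) r0; rewrite exprMn.
  rewrite -{1}mul2n exprM c2 exprVn mulrC ler_pdivrMr ?exprn_gt0 ?mulr_gt0 ?exprn_gt0//.
  by rewrite [X in _ -> _ <= X]mulrC.
rewrite !expectZ expectD exprMn.
have := bound false; have := bound true.
set x := expect _ _ _; set y := expect _ _ _ => hx hy.
rewrite -!mulrA ler_pM2l ?exprn_gt0 ?mulr_gt0 ?exprn_gt0// mulrC -!mulrA.
rewrite ler_pM2l ?exprn_gt0 ?ltr0n ?double_gt0//.
by rewrite mulrA ler_pM2r ?exprn_gt0//; lra.
Qed.

Lemma second_moment N :
  expect P N (fun s => (\sum_(a <- s) Y a) ^+ 2) = N%:R * rv_variance P Y.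
Proof.
elim: N => [|N IHN]; first by rewrite /= big_nil expr0n mul0r.
rewrite /= -natr1 mulrDl mul1r -IHN -[rv_variance P Y](expect_cst N _ hP) -expectD.
apply: eq_expect => s _; rewrite /rv_variance hm.
set S := \sum_(a <- s) Y a.
under eq_bigr => a _ do rewrite big_rcons/= -/S.
transitivity (\sum_a (S ^+ 2 * P a + 2 * S * (Y a * P a) + (Y a - 0) ^+ 2 * P a)).
  by apply: eq_bigr => a _; rewrite subr0; ring.
rewrite !big_split/= -!mulr_sumr P1 mulr1.
have -> : \sum_a Y a * P a = 0 by exact: hm.
by rewrite mulr0 addr0.
Qed.

End moments.

Section anticoncentration.
Context (R : realType) (Omega : finType) (P : Omega -> R)
  (hP : finite_prob_space P) (Y : Omega -> R) (B : R) (hB : 0 < B)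
  (hY : forall a, `|Y a| <= B) (hm : rv_mean P Y = 0) (hv : 0 < rv_variance P Y).

Let P0 : forall a, 0 <= P a. Proof. by case: hP. Qed.

(** The squared sum has mean [m%:R * v] and second moment of order [m ^ 2], so it cannot owe its
    mean to events of vanishing probability. *)
Lemma square_sum_large : exists2 p, 0 < p & forall m, (0 < m)%N ->
  p <= expect P m (fun s =>
    (m%:R * (rv_variance P Y / 2) <= (\sum_(a <- s) Y a) ^+ 2)%R%:R).
Proof.
have [C C0 hC] := even_moment hP hB hY hm (isT : (0 < 2)%N).
set v := rv_variance P Y; have v0 : 0 < v by [].
exists (v ^+ 2 / (4 * C)); first by rewrite divr_gt0 ?exprn_gt0 ?mulr_gt0.
move=> m m0; have m0' : 0 < m%:R :> R by rewrite ltr0n.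
set p := expect _ _ _.
(* With this [x] the fourth-moment term is [m%:R * v / 4]. Besides the threshold [m%:R * v / 2],
   this leaves [m%:R * v / 4] to be carried by the event. *)
pose x := v / (4 * C * m%:R).
have x0 : 0 < x by rewrite divr_gt0// !mulr_gt0.
have hx : m%:R * v <= m%:R * (v / 2) + x * (C * m%:R ^+ 2) + (4 * x)^-1 * p.
  rewrite -second_moment// -[X in X + _ + _ * p](expect_cst m _ hP).
  apply: (@le_trans _ _ (expect P m (fun s => m%:R * (v / 2) +
      x * (\sum_(a <- s) Y a) ^+ 4 + (4 * x)^-1 *
      (m%:R * (v / 2) <= (\sum_(a <- s) Y a) ^+ 2)%R%:R))).
    apply: expect_le => // s _; set z := _ ^+ 2.
    have -> : (\sum_(a <- s) Y a) ^+ 4 = z ^+ 2 by rewrite -exprM.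
    have z0 : 0 <= z by apply: sqr_ge0.
    case: (leP (m%:R * (v / 2)) z) => h; rewrite ?mulr1 ?mulr0 ?addr0.
      (* AM-GM on the event that the sum is large, as for Paley-Zygmund. *)
      have : 0 <= x * (z - (2 * x)^-1) ^+ 2 by rewrite mulr_ge0 ?sqr_ge0 ?ltW.
      have -> : x * (z - (2 * x)^-1) ^+ 2 = x * z ^+ 2 - z + (4 * x)^-1.
        by field; rewrite gt_eqF.
      have : 0 <= m%:R * (v / 2) by rewrite !mulr_ge0// ltW// divr_gt0.
      by lra.
    by rewrite (le_trans (ltW h))// lerDl mulr_ge0 ?sqr_ge0// ltW.
  rewrite !expectD !expectZ lerD2r lerD2l ler_pM2l//.
  exact: hC.
have -> : v ^+ 2 / (4 * C) = m%:R * (v / 4) * (4 * x).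
  by rewrite /x; field; rewrite !gt_eqF.
have x4 : 0 < 4 * x by lra.
rewrite -ler_pdivlMr// [leRHS]mulrC.
have : x * (C * m%:R ^+ 2) = m%:R * (v / 4).
  by rewrite /x; field; rewrite !gt_eqF.
move: hx; set y := _^-1 * p => hx hy; rewrite hy in hx.
by lra.
Qed.

(** One of the two signs carries at least half of the probability; which one may depend on [m]. *)
Lemma sum_large_sign : exists2 p, 0 < p & forall m, (0 < m)%N -> exists e : bool,
  p <= expect P m (fun s =>
    (Num.sqrt (m%:R * (rv_variance P Y / 2)) <= (-1) ^+ e * \sum_(a <- s) Y a)%R%:R).
Proof.
have [p p0 hp] := square_sum_large; exists (p / 2); first by rewrite divr_gt0.
move=> m m0; have := hp m m0; set u := m%:R * _.
pose q (e : bool) := expect P m (fun s =>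
  (Num.sqrt u <= (-1) ^+ e * \sum_(a <- s) Y a)%R%:R).
have hu : 0 <= u by rewrite mulr_ge0// divr_ge0// ltW.
move=> {}hp; have {}hp : p <= q false + q true.
  apply: (le_trans hp); rewrite -expectD; apply: expect_le => // s _.
  rewrite expr0 expr1 mul1r mulN1r; set z := \sum_(a <- s) _.
  rewrite -natrD ler_nat -[u in (u <= _)%R]sqr_sqrtr//.
  rewrite -[z ^+ 2]real_normK ?num_real// ler_sqr ?nnegrE ?sqrtr_ge0//.
  by rewrite ler_normr; case: (_ <= z)%R; case: (_ <= - z)%R.
have [h|h] := leP (p / 2) (q false); first by exists false.
by exists true; rewrite -/(q true); lra.
Qed.

(* Concatenating [L] blocks whose sums are large with the same sign gains a
   factor of order [sqrt L] over the standard deviation. *)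
Lemma sum_large_blocks L : exists2 p, 0 < p & forall m, (0 < m)%N ->
  p <= expect P (L * m) (fun s =>
    (L%:R ^+ 2 * (m%:R * (rv_variance P Y / 2)) <= (\sum_(a <- s) Y a) ^+ 2)%R%:R).
Proof.
have [p p0 hp] := sum_large_sign; exists (p ^+ L); first by rewrite exprn_gt0.
move=> m m0; have [e] := hp m m0; set u := m%:R * _ => he.
have hu : 0 <= u by rewrite mulr_ge0// divr_ge0// ltW.
apply: (@le_trans _ _ (expect P (L * m) (fun s =>
    (L%:R * Num.sqrt u <= (-1) ^+ e * \sum_(a <- s) Y a)%R%:R))); last first.
  apply: expect_le => // s _; rewrite ler_nat; case: leP => // h.
  suff -> : (L%:R ^+ 2 * u <= (\sum_(a <- s) Y a) ^+ 2) by [].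
  have -> : (\sum_(a <- s) Y a) ^+ 2 = ((-1) ^+ e * \sum_(a <- s) Y a) ^+ 2.
    by rewrite exprMn sqrr_sign mul1r.
  rewrite -(sqr_sqrtr hu) -exprMn.
  have h0 : 0 <= L%:R * Num.sqrt u by rewrite mulr_ge0 ?sqrtr_ge0.
  by rewrite ler_sqr ?nnegrE// (le_trans h0 h).
(* All blocks use the same sign [e], and independence multiplies their lower bounds [p]. *)
elim: L => [|L IHL].
  by rewrite expr0 /= big_nil mulr0 mul0r lexx.
rewrite mulSnr expect_cat exprSr.
apply: (@le_trans _ _ (expect P (L * m) (fun s =>
    p * (L%:R * Num.sqrt u <= (-1) ^+ e * \sum_(a <- s) Y a)%R%:R))).
  by rewrite expectZ mulrC ler_pM2l.
apply: expect_le => // s _; case: (leP (L%:R * _)) => h; last first.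
  by rewrite mulr0 expect_ge0// => s'; rewrite ler0n.
rewrite mulr1 (le_trans he)//; apply: expect_le => // s' _.
rewrite ler_nat; case: (leP (Num.sqrt u)) => // h'.
suff -> : (L.+1%:R * Num.sqrt u <= (-1) ^+ e * \sum_(a <- s ++ s') Y a) by [].
by rewrite -natr1 mulrDl mul1r big_cat/= mulrDr lerD.
Qed.

End anticoncentration.

(** * The two Schnorr tests *)

Definition dist_nat (m n : nat) : nat := ((m - n) + (n - m))%N.

Lemma natr_dist (R : realType) m n : (dist_nat m n)%:R = `|m%:R - n%:R| :> R.
Proof.
rewrite /dist_nat; case: (leqP m n) => mn.
  rewrite (eqP (_ : (m - n)%N == 0%N)) ?subn_eq0// add0n natrB// distrC.
  by rewrite ger0_norm// subr_ge0 ler_nat.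
rewrite (eqP (_ : (n - m)%N == 0%N)) ?subn_eq0 1?ltnW// addn0 natrB 1?ltnW//.
by rewrite ger0_norm// subr_ge0 ler_nat ltnW.
Qed.

(** Comparisons with the real number [k%:R * mu] need not be decidable; comparisons with the integer
    [h k] are. *)
Lemma computable_mean (R : realType) (Omega : finType) (P : Omega -> R)
    (X : Omega -> nat) : computable_prob_space P ->
  exists h : nat -> nat, recursive 1 (fun e => h (nth 0%N e 0)) /\
    forall k, `|k%:R * rv_mean P (fun a => (X a)%:R) - (h k)%:R| <= 2.
Proof.
move=> [hP cP]; set mu := rv_mean _ _.
have /choice[p hp] (a : Omega) : exists p : nat -> nat,
    recursive 1 (fun e => p (nth 0%N e 0)) /\
    forall k, (p k)%:R <= 2 ^+ k * P a <= (p k)%:R + 3.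
  by apply: computable_real_dyadic => //; case: hP.
pose S := (\sum_a X a)%N.
(* This precision ensures [k * (3 * S) <= 2 ^ prec k]: approximating [P] costs at most 1 after
   multiplication by [k], and the integer division at most 1 more. *)
pose prec k := (k + 3 * S)%N.
pose m k := (\sum_a X a * p a (prec k))%N.
exists (fun k => (k * m k) %/ 2 ^ prec k)%N; split.
  have rprec : recursive 1 (fun e => prec (nth 0 e 0))%N.
    by apply: recursive_add; [exact: recursive_var | exact: recursive_const].
  apply: recursive_div; last by apply: recursive_exp (recursive_const 1 2) rprec.
  apply: recursive_mul; first exact: recursive_var.
  apply: (recursive_bigsum _ (G := fun a e => X a * p a (prec (nth 0 e 0)))%N) => a.
  apply: recursive_mul; first exact: recursive_const.
  by case: (hp a) => hpa _; apply: (recursive_app1 hpa rprec).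
move=> k; set q := (_ %/ _)%N.
have hk : 0 < 2 ^+ prec k :> R by rewrite exprn_gt0.
have h1 : (m k)%:R <= 2 ^+ prec k * mu.
  rewrite natr_sum mulr_sumr; apply: ler_sum => a _; rewrite natrM mulrCA.
  by apply: ler_wpM2l => //; have [_ /(_ (prec k)) /andP[]] := hp a.
have h2 : 2 ^+ prec k * mu <= (m k + 3 * S)%N%:R.
  rewrite natrD natrM !natr_sum !mulr_sumr -big_split; apply: ler_sum => a _ /=.
  rewrite natrM mulrCA [3 * _]mulrC -mulrDr.
  by apply: ler_wpM2l => //; have [_ /(_ (prec k)) /andP[]] := hp a.
have h3 : (k * (3 * S) <= 2 ^ prec k)%N.
  by rewrite expnD; apply: leq_mul; apply: ltnW; apply: ltn_expl.
have h4 : (q * 2 ^ prec k <= k * m k)%N by apply: leq_trunc_div.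
have h5 : (k * m k <= q.+1 * 2 ^ prec k)%N by apply/ltnW/ltn_ceil; rewrite expn_gt0.
have h6 : 0 <= 2 ^+ prec k * (k%:R * mu - q%:R).
  rewrite mulrBr subr_ge0 mulrCA mulrC -natrX -natrM.
  rewrite (@le_trans _ _ (k * m k)%N%:R) ?ler_nat// natrM.
  by rewrite natrX ler_wpM2l.
have h7 : 2 ^+ prec k * (k%:R * mu - q%:R) <= 2 ^+ prec k * 2.
  rewrite mulrBr lerBlDr mulrCA.
  apply: (@le_trans _ _ (k%:R * (m k + 3 * S)%N%:R)); first by rewrite ler_wpM2l.
  rewrite -!natrX -!natrM -natrD ler_nat mulnDr.
  by move: h3 h5; rewrite mulSn; lia.
rewrite ger0_norm; first by move: h7; rewrite ler_pM2l.
by move: h6; rewrite pmulr_rge0.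
Qed.

Lemma has_prefix_step (Omega : Type) (chi : pred (seq Omega)) N s :
  size s = N.+1 -> has_prefix chi N.+1 s = has_prefix chi N (take N s) || chi s.
Proof.
move=> sN; rewrite /has_prefix -[N.+2]addn1 iotaD has_cat; congr (_ || _).
  apply: eq_in_has => m; rewrite mem_iota ltnS => mN.
  by rewrite take_takel.
by rewrite /= orbF add0n -sN take_size.
Qed.

Lemma expect_has_prefix_step (R : realType) (Omega : finType) (P : Omega -> R)
    (chi : pred (seq Omega)) N : finite_prob_space P ->
  expect P N.+1 (fun s => (has_prefix chi N.+1 s)%:R) <=
  expect P N (fun s => (has_prefix chi N s)%:R) +
    expect P N.+1 (fun s => (chi s)%:R).
Proof.
move=> hP; rewrite -(@expect_take _ _ _ N N.+1 _ hP)// -expectD.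
case: (hP) => P0 _; apply: expect_le => // s sN; rewrite has_prefix_step//.
by rewrite -natrD ler_nat; case: has_prefix; case: chi.
Qed.

Lemma expect_has_prefix_homo (R : realType) (Omega : finType) (P : Omega -> R)
    (chi : pred (seq Omega)) M N : finite_prob_space P -> (M <= N)%N ->
  expect P M (fun s => (has_prefix chi M s)%:R) <=
  expect P N (fun s => (has_prefix chi N s)%:R).
Proof.
move=> hP MN; rewrite -(expect_take _ hP MN).
case: (hP) => P0 _; apply: expect_le => // s sN; rewrite ler_nat.
have [/hasP[m]|//] := boolP (has_prefix chi M (take M s)).
rewrite mem_iota ltnS => mM hm.
suff -> : has_prefix chi N s by [].
apply/hasP; exists m; first by rewrite mem_iota ltnS (leq_trans mM).
by rewrite take_takel in hm.
Qed.

(** Decidable substitute for the absolute value of the centered sum, from which it differs by at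
    most 2 when [h] comes from [computable_mean]. *)
Definition mean_deviation (Omega : Type) (X : Omega -> nat) (h : nat -> nat)
    (s : seq Omega) :=
  dist_nat (\sum_(a <- s) X a) (h (size s)).

Lemma recursive_deviation (Omega : alphabetType) (X : Omega -> nat) h n f :
  recursive 1 (fun e => h (nth 0%N e 0)) -> recursive n f ->
  recursive n (fun e => mean_deviation X h (string_decode Omega (f e))).
Proof.
move=> hh hf; have hs := recursive_string_sum (G := fun a _ => X a)
  (fun a => recursive_const n (X a)) hf.
exact: (recursive_dist hs (recursive_app1 hh (recursive_string_size Omega hf))).
Qed.

Lemma sum_centered (R : realType) (Omega : finType) (X : Omega -> nat) (mu : R) s :
  \sum_(a <- s) ((X a)%:R - mu) = (\sum_(a <- s) X a)%N%:R - (size s)%:R * mu.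
Proof.
by rewrite sumrB natr_sum big_const_seq count_predT iter_addr_0 mulr_natl.
Qed.

Lemma mean_deviation_near (R : realType) (Omega : finType) (X : Omega -> nat)
    (mu : R) (h : nat -> nat) s :
  (forall k, `|k%:R * mu - (h k)%:R| <= 2) ->
  `|\sum_(a <- s) ((X a)%:R - mu)| - 2 <= (mean_deviation X h s)%:R
    <= `|\sum_(a <- s) ((X a)%:R - mu)| + 2.
Proof.
move=> /(_ (size s)); rewrite sum_centered natr_dist.
set x := (\sum_(a <- s) X a)%N%:R; set y := _ * mu; set z := (h _)%:R => hyz.
have := ler_normD (x - y) (y - z); have := ler_normD (x - z) (z - y).
rewrite !subrKA [`|z - y|]distrC => h1 h2.
by apply/andP; split; lra.
Qed.

(** * Upper deviations: moment bound, tail sums and the first test *)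

Section centered.
Context (R : realType) (Omega : finType) (P : Omega -> R)
  (hP : finite_prob_space P) (X : Omega -> nat).

Let mu := rv_mean P (fun a => (X a)%:R).
Let Y a : R := (X a)%:R - mu.

Lemma centered_mean : rv_mean P Y = 0.
Proof.
have [_ P1] := hP; rewrite /rv_mean.
under eq_bigr => a _ do rewrite mulrBl.
by rewrite sumrB -mulr_sumr P1 mulr1 subrr.
Qed.

Lemma centered_bounded : exists2 B : nat, (0 < B)%N & forall a, `|Y a| <= B%:R.
Proof.
exists (\sum_a X a).+1 => // a; rewrite /Y /mu.
have hX b : ((X b)%:R : R) <= (\sum_a X a)%N%:R.
  by rewrite ler_nat (bigD1 b)//= leq_addr.
have [P0 P1] := hP.
have h0 : 0 <= rv_mean P (fun a => (X a)%:R).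
  by apply: sumr_ge0 => b _; rewrite mulr_ge0.
have h1 : rv_mean P (fun a => (X a)%:R) <= (\sum_a X a)%N%:R.
  have -> : (\sum_a X a)%N%:R = (\sum_a X a)%N%:R * \sum_a P a by rewrite P1 mulr1.
  rewrite mulr_sumr; apply: ler_sum => b _.
  by rewrite ler_wpM2r.
have h2 := hX a; have h3 : 0 <= (X a)%:R :> R by [].
by rewrite -natr1 ler_norml; apply/andP; split; lra.
Qed.

(** Markov's inequality for the moment of order [4 * q]: squaring the event gives
    [k ^ (2 * q + 2) <= (2 * |S|) ^ (4 * q)], while the moment is of order [k ^ (2 * q)]. *)
Lemma large_deviation_bound q h : (0 < q)%N ->
  (forall k, `|k%:R * mu - (h k)%:R| <= 2) ->
  exists2 C, (0 < C)%N & forall k, (8 ^ q.*2 <= k)%N ->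
    expect P k (fun s => (k ^ q.+1 <= (mean_deviation X h s + 2) ^ q.*2)%N%:R)
    <= C%:R / k%:R ^+ 2.
Proof.
move=> q0 hh; have [P0 P1] := hP.
have [B B0 hB] := centered_bounded.
have hB0 : 0 < B%:R :> R by rewrite ltr0n.
have [C' C'0 hC'] := even_moment (conj P0 P1) hB0 hB centered_mean
  (etrans (double_gt0 q) q0).
(* The constant is rounded up to a natural number, so that it can enter the recursive thresholds of
   the test. *)
exists (Num.bound (2 ^+ q.*2.*2 * C')).+1 => // k hk.
have k0 : (0 < k)%N by apply: leq_trans hk; rewrite expn_gt0.
have k0' : 0 < k%:R :> R by rewrite ltr0n.
apply: (@le_trans _ _ (expect P k (fun s => 2 ^+ q.*2.*2 / k%:R ^+ q.+1.*2 *
    (\sum_(a <- s) Y a) ^+ q.*2.*2))).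
  apply: expect_le => // s sk.
  have /andP[_ hD] := mean_deviation_near X s hh.
  move: hD; rewrite -/(Y _) => hD.
  set S := \sum_(a <- s) Y a.
  have S0 : 0 <= S ^+ q.*2.*2 by rewrite -mul2n exprM exprn_ge0 ?sqr_ge0.
  case: leqP => hdev; last by rewrite mulr0n mulr_ge0// divr_ge0 ?exprn_ge0.
  have {}hdev : k%:R ^+ q.+1 <= (`|S| + 4) ^+ q.*2.
    apply: (@le_trans _ _ (((mean_deviation X h s + 2) ^ q.*2)%N%:R)).
      by rewrite -natrX ler_nat.
    rewrite natrX lerXn2r ?nnegrE ?addr_ge0// natrD.
    by have : `|\sum_(a <- s) ((X a)%:R - mu)| = `|S| by []; lra.
  (* Otherwise [k ^ q.+1 <= 8 ^ q.*2 <= k], which fails for [k > 1]. Hence the additive 4, that is,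
     the error 2 of the deviation plus the 2 in the event, is absorbed into the factor 2. *)
  have S4 : 4 < `|S|.
    rewrite ltNge; apply/negP => S4.
    have : k%:R ^+ q.+1 <= 8 ^+ q.*2 :> R.
      apply: (le_trans hdev); rewrite lerXn2r ?nnegrE ?addr_ge0//.
      by lra.
    rewrite -!natrX ler_nat leqNgt; apply/negP; rewrite negbK.
    apply: (leq_ltn_trans hk); rewrite -{1}[k]expn1 ltn_exp2l//.
    apply: leq_trans hk; apply: (@leq_trans (8 ^ 1)%N) => //.
    by rewrite leq_exp2l// double_gt0.
  have h1 : k%:R ^+ q.+1 <= (2 * `|S|) ^+ q.*2.
    by apply: (le_trans hdev); rewrite lerXn2r ?nnegrE ?addr_ge0 ?mulr_ge0//; lra.
  have : k%:R ^+ q.+1.*2 <= (2 * `|S|) ^+ q.*2.*2.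
    have E (x : R) n : x ^+ n.*2 = (x ^+ n) ^+ 2 by rewrite -exprM muln2.
    by rewrite (E _ q.+1) (E _ q.*2) lerXn2r// nnegrE ?exprn_ge0 ?mulr_ge0.
  rewrite exprMn -[`|S| ^+ _]normrX (ger0_norm S0) => h2.
  by rewrite mulr1n mulrAC ler_pdivlMr ?exprn_gt0// mul1r.
rewrite expectZ; apply: (@le_trans _ _
  (2 ^+ q.*2.*2 / k%:R ^+ q.+1.*2 * (C' * k%:R ^+ q.*2))).
  by rewrite ler_wpM2l ?hC'// divr_ge0 ?exprn_ge0.
have -> : 2 ^+ q.*2.*2 / k%:R ^+ q.+1.*2 * (C' * k%:R ^+ q.*2) =
    (2 ^+ q.*2.*2 * C') / k%:R ^+ 2.
  have -> : k%:R ^+ q.+1.*2 = k%:R ^+ q.*2 * k%:R ^+ 2 :> R.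
    by rewrite -exprD addn2 doubleS.
  have : k%:R ^+ q.*2 != 0 :> R by rewrite expf_neq0// gt_eqF.
  set z := _ ^+ q.*2 => z0; set y := 2 ^+ _; field.
  by rewrite z0 gt_eqF.
rewrite ler_wpM2r ?invr_ge0 ?exprn_ge0// (le_trans (ltW (archi_boundP _)))//.
  by rewrite mulr_ge0 ?exprn_ge0// ltW.
by rewrite ler_nat.
Qed.

End centered.

(** A union bound over the lengths beyond [M], where [1 / (x + 1) ^ 2 <= 1 / x - 1 / (x + 1)] makes
    the sum telescope. *)
Lemma expect_prefix_tail (R : realType) (Omega : finType) (P : Omega -> R)
    (chi : pred (seq Omega)) (C : R) M N : finite_prob_space P ->
  0 <= C -> (0 < M)%N ->
  (forall k, (M < k)%N -> expect P k (fun s => (chi s)%:R) <= C / k%:R ^+ 2) ->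
  expect P N (fun s => (has_prefix chi N s)%:R) <=
  expect P M (fun s => (has_prefix chi M s)%:R) + C / M%:R.
Proof.
move=> hP C0 M0 hC; have M0' : 0 < M%:R :> R by rewrite ltr0n.
have [NM|/ltnW MN] := leqP N M.
  by rewrite (le_trans (expect_has_prefix_homo chi hP NM))// lerDl divr_ge0// ltW.
suff h : expect P N (fun s => (has_prefix chi N s)%:R) <=
    expect P M (fun s => (has_prefix chi M s)%:R) + (C / M%:R - C / N%:R).
  by apply: (le_trans h); rewrite lerD2l gerBl divr_ge0.
rewrite -(subnKC MN); elim: (N - M)%N => [|n IHn].
  by rewrite addn0 subrr addr0.
rewrite addnS; apply: (le_trans (expect_has_prefix_step _ _ hP)).
apply: (le_trans (lerD IHn (hC _ _))); first by rewrite ltnS leq_addr.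
rewrite -addrA lerD2l -addrA lerD2l; set m := (M + n)%N.
have m0 : 0 < m%:R :> R by rewrite ltr0n addn_gt0 M0.
rewrite -natr1; move: m0; set x := m%:R => x0.
suff : C / (x + 1) ^+ 2 <= C * (x^-1 - (x + 1)^-1) by rewrite mulrBr; lra.
apply: ler_wpM2l => //.
have -> : x^-1 - (x + 1)^-1 = (x * (x + 1))^-1.
  by field; rewrite !gt_eqF// addr_gt0.
by rewrite lef_pV2 ?posrE ?mulr_gt0 ?exprn_gt0 ?addr_gt0//; nra.
Qed.

Lemma sum_mkseq (V : nmodType) (T : Type) (alpha : nat -> T) k (G : T -> V) :
  \sum_(a <- mkseq alpha k) G a = \sum_(i < k) G (alpha i).
Proof. by rewrite big_map -{1}[k]subn0 big_mkord. Qed.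

Lemma upper_deviation (R : realType) (Omega : alphabetType) (P : Omega -> R)
    (lam : probability (seq_space Omega) R) (X : Omega -> nat) alpha q :
  computable_prob_space P -> is_bernoulli_measure P lam ->
  schnorr_random lam alpha -> (0 < q)%N ->
  exists K, forall k, (K <= k)%N ->
    `|\sum_(i < k) (X (alpha i))%:R - k%:R * rv_mean P (fun a => (X a)%:R)| ^+ q.*2
    < k%:R ^+ q.+1 :> R.
Proof.
move=> hP hlam ha q0; set mu := rv_mean _ _.
have [h [rh hh]] := computable_mean X hP.
have [C C0 hC] := large_deviation_bound (proj1 hP) q0 hh.
(* The first summand makes [large_deviation_bound] applicable; the second makes the tail
   [C / start n] at most [2 ^- n.+1]. *)
pose start n := (8 ^ q.*2 + C * 2 ^ n.+1)%N.
(* The [+ 2] makes up for the error of [mean_deviation]: wherever the event fails, the true sum is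
   below the bound. *)
pose chi n s := ((start n < size s) &&
  ((size s) ^ q.+1 <= (mean_deviation X h s + 2) ^ q.*2))%N.
have bound n k : (start n <= k)%N ->
    expect P k (fun s => (chi n s)%:R) <= C%:R / k%:R ^+ 2.
  move=> nk; apply: le_trans (hC k _); last first.
    by apply: leq_trans nk; apply: leq_addr.
  have [[P0 _] _] := hP; apply: expect_le => // s sk.
  by rewrite /chi sk ler_nat; case: (start n < k)%N.
have start0 n : (0 < start n)%N by rewrite addn_gt0 expn_gt0.
have empty n : expect P (start n) (fun s => (has_prefix (chi n) (start n) s)%:R) = 0.
  rewrite -(expect_cst (start n) 0 (proj1 hP)); apply: eq_expect => s sn.
  have [/hasP[m _]|//] := boolP (has_prefix _ _ s).
  by rewrite /chi size_take_min sn ltnNge geq_minr.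
have small m M : (C * 2 ^ m <= M)%N -> (0 < M)%N -> C%:R / M%:R <= 2 ^- m :> R.
  move=> hM M0; rewrite ler_pdivrMr ?ltr0n// mulrC ler_pdivlMr ?exprn_gt0//.
  by rewrite -(natrX R 2) -natrM ler_nat.
have rchi : recursive 2 (fun e => chi (nth 0 e 0) (string_decode Omega (nth 0 e 1)))%N.
  have rs := recursive_string_size Omega (recursive_var (isT : 1 < 2)%N).
  apply: recursive_and.
    apply: recursive_leq rs; apply: recursive_succ; apply: recursive_add.
      exact: recursive_const.
    apply: recursive_mul; first exact: recursive_const.
    apply: (recursive_exp (recursive_const 2 2)).
    by apply: recursive_succ; apply: recursive_var.
  apply: recursive_leq.
    exact: (recursive_exp rs (recursive_const 2 _)).
  apply: recursive_exp; last exact: recursive_const.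
  apply: recursive_add; last exact: recursive_const.
  by apply: recursive_deviation => //; apply: recursive_var.
(* Beyond this horizon the tail adds at most [2 ^- j.+1]. *)
pose Nf n j := (start n + C * 2 ^ j.+1)%N.
have /ha[n n0 hn] : schnorr_test lam [set ns | (0 < ns.1)%N && chi ns.1 ns.2].
  apply: (schnorr_test_criterion (P := P) (Nf := Nf)) => //.
  - apply: recursive_add.
      apply: recursive_add; first exact: recursive_const.
      apply: recursive_mul; first exact: recursive_const.
      apply: (recursive_exp (recursive_const 2 2)).
      by apply: recursive_succ; apply: recursive_var.
    apply: recursive_mul; first exact: recursive_const.
    apply: (recursive_exp (recursive_const 2 2)).
    by apply: recursive_succ; apply: recursive_var.
  - move=> n N n0.
    apply: le_trans (expect_prefix_tail N (proj1 hP) (ler0n R C) (start0 n) _) _.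
    + by move=> k nk; apply: bound; apply: ltnW.
    + by rewrite empty add0r small// leq_addl.
  - move=> n j N n0.
    have Nf0 : (0 < Nf n j)%N by rewrite addn_gt0 start0.
    apply: le_trans (expect_prefix_tail N (proj1 hP) (ler0n R C) Nf0 _) _.
    + by move=> k nk; apply: bound; apply: leq_trans (ltnW nk); apply: leq_addr.
    + by rewrite lerD2l small// leq_addl.
exists (start n).+1 => k hk.
have : ~~ chi n (mkseq alpha k).
  by apply/negP => hchi; apply: hn; exists k; rewrite /section /= n0.
rewrite /chi size_mkseq hk /= -ltnNge => hdev.
have /andP[hD _] := mean_deviation_near X (mkseq alpha k) hh.
have -> : \sum_(i < k) (X (alpha i))%:R - k%:R * mu =
    \sum_(a <- mkseq alpha k) ((X a)%:R - mu).
  by rewrite sum_mkseq sumrB sumr_const card_ord mulr_natl.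
apply: (@le_lt_trans _ _ ((mean_deviation X h (mkseq alpha k) + 2) ^ q.*2)%N%:R).
  by rewrite natrX lerXn2r ?nnegrE// natrD; lra.
by rewrite -natrX ltr_nat.
Qed.

(** * Lower deviations: repeated failures along squared scales *)

Lemma expr_le_half (R : realType) (p : R) : 0 < p <= 1 ->
  exists2 g, (0 < g)%N & (1 - p) ^+ g <= 2^-1.
Proof.
move=> /andP[p0 p1].
(* A Bernoulli-type inequality; once [g%:R * p >= 1], the second factor is at least 2. *)
have h n : (1 - p) ^+ n * (1 + n%:R * p) <= 1.
  elim: n => [|n IHn]; first by rewrite expr0 mul1r mul0r addr0.
  apply: le_trans IHn; rewrite exprSr -mulrA ler_wpM2l ?exprn_ge0 ?subr_ge0//.
  by rewrite -natr1; have := ler0n R n; nra.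
exists (Num.bound p^-1).+1 => //; set g := _.+1.
have hg : 1 <= g%:R * p.
  rewrite -ler_pdivrMr// mul1r (le_trans (ltW (archi_boundP _))) ?invr_ge0 ?ltW//.
  by rewrite ltr_nat.
have := h g; have : 0 <= (1 - p) ^+ g by rewrite exprn_ge0 ?subr_ge0.
by nra.
Qed.

(** Sums are inspected at the times [square_scale L j ^ 2], each of which is the square of the
    preceding one. *)
Definition square_scale L j := (L ^ 2 ^ j)%N.

Lemma square_scaleS L j : square_scale L j.+1 = (square_scale L j ^ 2)%N.
Proof. by rewrite /square_scale expnSr expnM. Qed.

(** Failure at the [i] scales following [J]. The [+ 2] ensures that a true sum below [A] times the
    scale is counted as a failure despite the error of [mean_deviation]. *)
Definition small_deviations (Omega : Type) (X : Omega -> nat) h A L J i (s : seq Omega) :=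
  all (fun t => mean_deviation X h (take (square_scale L (J + t).+1 ^ 2) s) <
     A * square_scale L (J + t).+1 + 2)%N (iota 0 i).

Lemma small_deviationsS (Omega : Type) (X : Omega -> nat) h A L J i (s : seq Omega) :
  small_deviations X h A L J i.+1 s = small_deviations X h A L J i s &&
    (mean_deviation X h (take (square_scale L (J + i).+1 ^ 2) s) <
     A * square_scale L (J + i).+1 + 2)%N.
Proof.
rewrite /small_deviations -[i.+1]addn1 iotaD all_cat; congr (_ && _).
by rewrite /= andbT.
Qed.

Lemma small_deviations_cat (Omega : Type) (X : Omega -> nat) h A L J i
    (s s' : seq Omega) : (0 < L)%N -> size s = (square_scale L (J + i) ^ 2)%N ->
  small_deviations X h A L J i (s ++ s') = small_deviations X h A L J i s.
Proof.
move=> L0 sN; apply: eq_in_all => t; rewrite mem_iota add0n => ti.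
rewrite takel_cat// sN leq_exp2r// leq_pexp2l// leq_pexp2l//.
by rewrite -addnS leq_add2l.
Qed.

Section lower.
Context (R : realType) (Omega : finType) (P : Omega -> R)
  (hP : finite_prob_space P) (X : Omega -> nat)
  (hv : 0 < rv_variance P (fun a => (X a)%:R)).

Let mu := rv_mean P (fun a => (X a)%:R).
Let Y a : R := (X a)%:R - mu.

Lemma centered_variance : rv_variance P Y = rv_variance P (fun a => (X a)%:R).
Proof.
apply: eq_bigr => a _; have -> : rv_mean P Y = 0 by exact: centered_mean.
by rewrite subr0.
Qed.

(** Given any past, the next scale fails with probability at most [1 - p]; the constants [L] and [p]
    do not depend on [J] and [i]. *)
Lemma small_deviations_bound h A : (forall k, `|k%:R * mu - (h k)%:R| <= 2) ->
  exists L p, [/\ (1 < L)%N, 0 < p <= 1 & forall J i,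
    expect P (square_scale L (J + i) ^ 2)
      (fun s => (small_deviations X h A L J i s)%:R) <= (1 - p) ^+ i].
Proof.
move=> hh; have [P0 P1] := hP.
have [B B0 hB] := centered_bounded hP X.
have hB0 : 0 < B%:R :> R by rewrite ltr0n.
set v := rv_variance P Y; have v0 : 0 < v by rewrite /v centered_variance.
(* [A + 4] bounds the allowed deviation with its errors and [B] the past, all in units of the scale.
   [L] is then chosen so that the gain from [L] blocks exceeds this bound. *)
pose D := ((A + 4 + B) ^ 2)%N.
pose L := (Num.bound (4 * D%:R / v)).+2.
have hL : 4 * D%:R <= L%:R * v.
  rewrite -ler_pdivrMr// (le_trans (ltW (archi_boundP _)))//.
    by rewrite divr_ge0 ?mulr_ge0// ltW.
  by rewrite ler_nat /L ltnW.
have [p p0 hp] := sum_large_blocks hP hB0 hB (centered_mean hP X) v0 L.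
have p1 : p <= 1.
  apply: (le_trans (hp 1%N isT)); rewrite -[leRHS](expect_cst (L * 1) 1 hP).
  by apply: expect_le => // s _; rewrite lern1 leq_b1.
exists L, p; split=> //; first by rewrite p0.
move=> J; elim=> [|i IHi].
  rewrite expr0 -[leRHS](expect_cst (square_scale L (J + 0) ^ 2) 1 hP).
  by apply: expect_le => // s _; rewrite lern1 leq_b1.
set N := (square_scale L (J + i) ^ 2)%N in IHi *.
have LN : (L %| N)%N by rewrite !dvdn_exp// expn_gt0.
have N1 : (1 < N)%N by apply: leq_trans (dvdn_leq _ LN) => //; rewrite !expn_gt0.
(* [N] is both the current time and the next scale, and the next time is [N ^ 2]. As [L] divides
   [N], the stretch of length [N * N.-1] in between splits into [L] equal blocks. *)
pose m := (N %/ L * N.-1)%N.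
have LmE : (L * m)%N = (N * N.-1)%N by rewrite mulnA [(L * _)%N]mulnC divnK.
have m0 : (0 < m)%N.
  rewrite -(ltn_pmul2l (isT : (0 < L)%N)) muln0 LmE.
  by move: N1; case: (N) => [|[|k]].
have -> : (square_scale L (J + i.+1) ^ 2)%N = (N + L * m)%N.
  by rewrite addnS square_scaleS -/N LmE -mulnS prednK// ltnW.
rewrite expect_cat exprSr.
apply: (@le_trans _ _ (expect P N (fun s =>
    (1 - p) * (small_deviations X h A L J i s)%:R))); last first.
  by rewrite expectZ mulrC ler_wpM2r// subr_ge0.
apply: expect_le => // s sN.
(* The past contributes at most [B * N] to the sum at time [N ^ 2], so a large
   sum over the new block forces a large deviation at that time. *)
have key s' : size s' = (L * m)%N ->
    (small_deviations X h A L J i.+1 (s ++ s'))%:R <=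
    (small_deviations X h A L J i s)%:R + - (small_deviations X h A L J i s)%:R *
      (L%:R ^+ 2 * (m%:R * (v / 2)) <= (\sum_(a <- s') Y a) ^+ 2)%R%:R :> R.
  move=> sm; rewrite small_deviationsS small_deviations_cat//.
  case: small_deviations => /=; last by rewrite oppr0 mul0r addr0.
  rewrite mulN1r; case: (leP (L%:R ^+ 2 * _)) => hlarge; last by rewrite subr0 lern1 leq_b1.
  rewrite subrr; case: ltnP => // hsmall; exfalso.
  move: hsmall; rewrite square_scaleS -/N take_oversize; last first.
    by rewrite size_cat sN sm LmE -mulnS prednK// ltnW.
  rewrite -(ltr_nat R) natrD natrM => hsmall.
  have /andP[hD _] := mean_deviation_near X (s ++ s') hh.
  have hs : `|\sum_(a <- s) Y a| <= B%:R * N%:R.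
    rewrite -sN; apply: le_trans (ler_norm_sum _ _ _) _.
    rewrite mulr_natr -[_ *+ _]iter_addr_0 -[size s](count_predT s) -big_const_seq.
    apply: ler_sum => a _; exact: hB.
  have hss : `|\sum_(a <- s') Y a| < (A + 4 + B)%N%:R * N%:R.
    have -> : \sum_(a <- s') Y a = \sum_(a <- s ++ s') Y a - \sum_(a <- s) Y a.
      by rewrite big_cat/= addrAC subrr add0r.
    apply: (le_lt_trans (ler_normB _ _)).
    have N2 : 2 <= N%:R :> R by rewrite ler_nat.
    have : `|\sum_(a <- s ++ s') Y a| - 2 < A%:R * N%:R + 2.
      exact: le_lt_trans hD hsmall.
    by rewrite !natrD !mulrDl; lra.
  have : (\sum_(a <- s') Y a) ^+ 2 < D%:R * N%:R ^+ 2.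
    rewrite natrX -exprMn -real_normK ?num_real//.
    by rewrite ltr_pXn2r// nnegrE mulr_ge0.
  move=> /(le_lt_trans hlarge); apply/negP; rewrite -leNgt.
  have -> : L%:R ^+ 2 * (m%:R * (v / 2)) = (L * m)%N%:R * (L%:R * v) / 2.
    by rewrite natrM; ring.
  rewrite LmE natrM -subn1 natrB 1?ltnW//.
  have N2 : 2 <= N%:R :> R by rewrite ler_nat.
  have D0 : 0 <= D%:R :> R by [].
  rewrite ler_pdivlMr//; apply: (@le_trans _ _ (N%:R * (N%:R - 1) * (4 * D%:R))).
    move: D0 N2; move: (D%:R : R) (N%:R : R) => d x d0 x2.
    have : 0 <= d * x * (x - 2) by rewrite !mulr_ge0//; lra.
    have -> : d * x * (x - 2) = d * x ^+ 2 - 2 * (d * x) by ring.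
    have -> : x * (x - 1) * (4 * d) = 4 * (d * x ^+ 2) - 4 * (d * x) by ring.
    by lra.
  by rewrite ler_wpM2l// mulr_ge0//; lra.
apply: le_trans (expect_le _ key) _ => //.
rewrite expectD expectZ expect_cst//; have := hp m m0.
set E := expect _ _ _ => hE; have : 0 <= (small_deviations X h A L J i s)%:R :> R by [].
by case: small_deviations; rewrite ?mulr0n ?mulr1n; lra.
Qed.

End lower.

Lemma recursive_square_scale L n f : recursive n f ->
  recursive n (fun e => square_scale L (f e)).
Proof.
move=> hf; apply: (recursive_exp (recursive_const n L)).
exact: (recursive_exp (recursive_const n 2) hf).
Qed.

Lemma recursive_small_deviations (Omega : alphabetType) (X : Omega -> nat) h A L J n g f :
  recursive 1 (fun e => h (nth 0%N e 0)) -> recursive n g -> recursive n f ->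
  recursive n (fun e => small_deviations X h A L J (g e) (string_decode Omega (f e))).
Proof.
move=> hh hg hf.
pose scale t := square_scale L (J + t).+1.
have rscale : recursive n.+1 (fun e => scale (head 0%N e)).
  apply: recursive_square_scale; apply: recursive_succ.
  by apply: recursive_add (recursive_const _ _) (recursive_head _).
apply: (recursive_all (G := fun t e =>
  (mean_deviation X h (take (scale t ^ 2) (string_decode Omega (f e))) <
     A * scale t + 2)%N)) => //.
apply: (@recursive_leq _ (fun e => (mean_deviation X h
    (take (scale (head 0%N e) ^ 2) (string_decode Omega (f (behead e))))).+1)).
  have rtake := recursive_string_take Omega
    (recursive_exp rscale (recursive_const _ 2)) (recursive_weaken hf).
  apply: recursive_succ; have := recursive_deviation X hh rtake.
  by apply: recursive_ext => e _; rewrite string_codeK.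
apply: recursive_add (recursive_const _ _).
exact: (recursive_mul (recursive_const _ A) rscale).
Qed.

(** If the bound failed for all [n >= M], the sequence would fail at every scale after [M] and thus
    lie in every level of a Schnorr test. *)
Lemma lower_deviation (R : realType) (Omega : alphabetType) (P : Omega -> R)
    (lam : probability (seq_space Omega) R) (X : Omega -> nat) alpha A M :
  computable_prob_space P -> is_bernoulli_measure P lam ->
  0 < rv_variance P (fun a => (X a)%:R) -> schnorr_random lam alpha ->
  exists2 n, (M <= n)%N & A%:R * n%:R <= `|\sum_(i < n ^ 2) (X (alpha i))%:R
    - (n ^ 2)%N%:R * rv_mean P (fun a => (X a)%:R)| :> R.
Proof.
move=> hP hlam hv ha; set mu := rv_mean _ _; apply: contrapT => hno.
have {}hno n : (M <= n)%N -> `|\sum_(a <- mkseq alpha (n ^ 2)) ((X a)%:R - mu)| < A%:R * n%:R.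
  move=> Mn; rewrite ltNge; apply/negP => hn; apply: hno; exists n => //.
  by move: hn; rewrite sum_centered size_mkseq natr_sum sum_mkseq.
have [h [rh hh]] := computable_mean X hP.
have [L [p [L1 p01 bound]]] := small_deviations_bound (proj1 hP) hv A hh.
have [g g0 hg] := expr_le_half p01.
(* [g * n.+1] failures have probability at most [2 ^- n.+1]. The event is decided at this single
   length, which therefore serves as the horizon for every precision [j]. *)
pose len n := (square_scale L (M + g * n.+1) ^ 2)%N.
pose chi n s := ((size s == len n) && small_deviations X h A L M (g * n.+1) s)%N.
have rlen m f : recursive m f -> recursive m (fun e => len (f e)).
  move=> hf; apply: recursive_exp (recursive_const _ _).
  apply: recursive_square_scale; apply: recursive_add (recursive_const _ _) _.
  by apply: recursive_mul (recursive_const _ _) _; apply: recursive_succ.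
have rchi : recursive 2 (fun e => chi (nth 0 e 0) (string_decode Omega (nth 0 e 1)))%N.
  apply: recursive_and.
    apply: recursive_eq; first by apply: recursive_string_size; apply: recursive_var.
    by apply: rlen; apply: recursive_var.
  apply: recursive_small_deviations => //; last exact: recursive_var.
  by apply: recursive_mul (recursive_const _ _) _; apply/recursive_succ/recursive_var.
have le_len n N : expect P N (fun s => (has_prefix (chi n) N s)%:R) <=
    expect P (len n) (fun s => (chi n s)%:R).
  have [[P0 _] _] := hP; have hP' := proj1 hP.
  have [lN|Nl] := leqP (len n) N.
    rewrite -(expect_take _ hP' lN); apply: expect_le => // s sN; rewrite ler_nat.
    have [/hasP[m]|//] := boolP (has_prefix _ _ s).
    rewrite mem_iota ltnS => /andP[_ mN] hm.
    have /andP[/eqP sm _] := hm; rewrite size_takel ?sN// in sm.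
    by rewrite -sm hm.
  apply: (@le_trans _ _ 0); last by apply: expect_ge0.
  rewrite -[leRHS](expect_cst N 0 hP'); apply: expect_le => // s sN.
  have [/hasP[m]|//] := boolP (has_prefix _ _ s).
  rewrite mem_iota ltnS => /andP[_ mN] /andP[/eqP sm _].
  by rewrite size_takel ?sN// in sm; move: Nl; rewrite -sm ltnNge mN.
have ge_len n : expect P (len n) (fun s => (chi n s)%:R) <=
    expect P (len n) (fun s => (has_prefix (chi n) (len n) s)%:R).
  have [[P0 _] _] := hP; apply: expect_le => // s sN; rewrite ler_nat.
  have [hs|//] := boolP (chi n s); suff -> : has_prefix (chi n) (len n) s by [].
  by apply/hasP; exists (len n); rewrite ?mem_iota ?ltnS ?leqnn// take_oversize ?sN.
have /ha[n n0 hn] : schnorr_test lam [set ns | (0 < ns.1)%N && chi ns.1 ns.2].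
  apply: (schnorr_test_criterion (P := P) (Nf := fun n _ => len n)) => //.
  - by apply: rlen; apply: recursive_var.
  - move=> n N n0; apply: (le_trans (le_len n N)).
    have -> : 2 ^- n.+1 = (2^-1 ^+ n.+1 : R) by rewrite exprVn.
    apply: (@le_trans _ _ ((1 - p) ^+ (g * n.+1))); last first.
      have /andP[p0 p1] := p01.
      by rewrite exprM lerXn2r ?nnegrE ?exprn_ge0 ?subr_ge0 ?invr_ge0.
    apply: le_trans (bound M (g * n.+1)%N).
    have [[P0 _] _] := hP; apply: expect_le => // s _.
    by rewrite ler_nat /chi; case: (size s == _).
  - move=> n j N n0; apply: (le_trans (le_len n N)); apply: (le_trans (ge_len n)).
    by rewrite lerDl invr_ge0 exprn_ge0.
apply: hn; exists (len n); rewrite /section /= n0 /= /chi size_mkseq eqxx /=.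
apply/allP => t; rewrite mem_iota add0n => /andP[_ ht].
set m := square_scale L (M + t).+1.
have -> : take (m ^ 2) (mkseq alpha (len n)) = mkseq alpha (m ^ 2).
  rewrite -map_take take_iota (minn_idPl _)// leq_exp2r// leq_pexp2l ?(ltnW L1)//.
  by rewrite leq_pexp2l// -addnS leq_add2l.
rewrite -(ltr_nat R) natrD natrM.
have /andP[_ hD] := mean_deviation_near X (mkseq alpha (m ^ 2)) hh.
apply: (le_lt_trans hD); rewrite ltrD2r; apply: hno.
(* Scales exceed their index, so every scale inspected is at least [M]. *)
rewrite (@leq_trans (M + t).+1)//; first by rewrite ltnW// ltnS leq_addr.
by apply: leq_trans (ltnW (ltn_expl _ (isT : (1 < 2)%N))) _; apply/ltnW/ltn_expl.
Qed.

(** * Clearing denominators and the equivalence *)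

Lemma rational_scaling (R : realType) (Omega : finType) (X : Omega -> R) :
  (forall a, exists q : rat, X a = ratr q) ->
  exists (w s : nat) (X' : Omega -> nat),
    (0 < w)%N /\ forall a, (X' a)%:R = w%:R * X a + s%:R.
Proof.
move=> /choice[q Xq].
pose w := (\prod_a `|denq (q a)|)%N.
have w0 : (0 < w)%N by apply: prodn_gt0 => a; rewrite absz_gt0 denq_eq0.
have /choice[z hz] a : exists z : int, w%:R * X a = z%:~R.
  exists (numq (q a) * (\prod_(b | b != a) `|denq (q b)|)%N%:Z).
  rewrite Xq -[in ratr (q a)](divq_num_den (q a)) /w (bigD1 a)//= natrM.
  rewrite fmorph_div/= !ratr_int rmorphM/= mulrAC.
  rewrite natr_absz gtr0_norm ?denq_gt0// [X in X * _]mulrC mulfVK//.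
  by rewrite intr_eq0 denq_eq0.
(* A shift by this sum makes all the integers [z a] non-negative. *)
pose s := (\sum_a `|z a|)%N.
exists w, s, (fun a => absz (z a + s%:Z)%R); split=> // a.
have h : 0 <= z a + s%:Z.
  rewrite -lerBlDl sub0r (le_trans (ler_norm _))// normrN -abszE lez_nat.
  by rewrite /s (bigD1 a)//= leq_addr.
by rewrite natr_absz ger0_norm// rmorphD/= hz.
Qed.

Lemma rv_mean_affine (R : realType) (Omega : finType) (P X : Omega -> R) w s :
  finite_prob_space P ->
  rv_mean P (fun a => w * X a + s) = w * rv_mean P X + s.
Proof.
move=> [_ P1]; rewrite /rv_mean mulr_sumr -[X in _ + X]mulr1 -[in X in _ + X]P1.
by rewrite mulr_sumr -big_split; apply: eq_bigr => a _ /=; rewrite mulrDl mulrA.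
Qed.

Lemma rv_variance_affine (R : realType) (Omega : finType) (P X : Omega -> R) w s :
  finite_prob_space P ->
  rv_variance P (fun a => w * X a + s) = w ^+ 2 * rv_variance P X.
Proof.
move=> hP; rewrite /rv_variance mulr_sumr; apply: eq_bigr => a _.
by rewrite rv_mean_affine//; ring.
Qed.

(** Trades the real exponent [t] for integer powers: raise [n ^ t <= k] to the power [q] and use
    [2 * (q + 1) <= t * q]. *)
Lemma powR_le_root (R : realType) (t : R) (q n k : nat) :
  (0 < n)%N -> (q.+1).*2%:R <= t * q%:R -> n%:R `^ t <= k%:R ->
  n%:R ^+ q.+1.*2 <= k%:R ^+ q :> R.
Proof.
move=> n0 hq hk; rewrite -powR_mulrn//.
apply: (@le_trans _ _ (n%:R `^ (t * q%:R))); first by rewrite ler_powR// ler1n.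
by rewrite powRrM powR_mulrn ?powR_ge0// lerXn2r ?nnegrE ?powR_ge0.
Qed.

Theorem theorem22 (R : realType) (Omega : alphabetType) (P : Omega -> R)
    (hP : computable_prob_space P)
    (lam : probability (seq_space Omega) R)
    (hlam : is_bernoulli_measure P lam)
    (X : Omega -> R)
    (hXrat : forall a, exists q : rat, X a = ratr q)
    (hV : 0 < rv_variance P X)
    (alpha : nat -> Omega)
    (halpha : schnorr_random lam alpha)
    (t : R) (ht : 0 < t) :
  (exists2 M : nat, (0 < M)%N &
     forall n k : nat, (M <= n)%N -> (0 < k)%N -> n%:R `^ t <= k%:R :> R ->
       `|k%:R^-1 * (\sum_(i < k) X (alpha i)) - rv_mean P X| < n%:R^-1)
  <-> 2 < t.
Proof.
have [w [s [X' [w0 X'E]]]] := rational_scaling hXrat.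
have w0' : 0 < w%:R :> R by rewrite ltr0n.
have X'fE : (fun a => (X' a)%:R) = (fun a => w%:R * X a + s%:R) by apply/funext.
pose S k := \sum_(i < k) (X' (alpha i))%:R - k%:R * rv_mean P (fun a => (X' a)%:R).
(* The shift [s] cancels against the mean, and clearing denominators leaves a condition on the
   centered sums of [X']. *)
have SE n k : (0 < n)%N -> (0 < k)%N ->
    (`|k%:R^-1 * (\sum_(i < k) X (alpha i)) - rv_mean P X| < n%:R^-1) =
    (`|S k| * n%:R < w%:R * k%:R).
  move=> n0 k0; have k0' : 0 < k%:R :> R by rewrite ltr0n.
  have -> : S k = w%:R * k%:R * (k%:R^-1 * (\sum_(i < k) X (alpha i)) - rv_mean P X).
    rewrite /S X'fE rv_mean_affine; last by case: hP.
    under eq_bigr => i _ do rewrite X'E.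
    rewrite big_split/= -mulr_sumr sumr_const card_ord -mulr_natr.
    by field; rewrite gt_eqF.
  set x := _ - rv_mean P X.
  rewrite normrM gtr0_norm ?mulr_gt0// -mulrA -[X in _ = (_ < X)]mulr1 ltr_pM2l ?mulr_gt0//.
  by rewrite -ltr_pdivlMr ?ltr0n// div1r.
split=> [[M M0 hM]|t2].
  rewrite ltNge; apply/negP => t2.
  have hV' : 0 < rv_variance P (fun a => (X' a)%:R).
    by rewrite X'fE rv_variance_affine ?mulr_gt0 ?exprn_gt0//; case: hP.
  (* The counterexample is [k = n ^ 2], admissible because [t <= 2]; the factor [A = w] undoes the
     scaling of [X]. *)
  have [n Mn] := lower_deviation w M hP hlam hV' halpha; rewrite -/(S _) => hn.
  have n0 : (0 < n)%N by apply: leq_trans Mn.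
  have n20 : (0 < n ^ 2)%N by rewrite expn_gt0 n0.
  have hk : n%:R `^ t <= (n ^ 2)%N%:R :> R.
    by rewrite natrX -powR_mulrn// ler_powR// ler1n.
  have := hM n (n ^ 2)%N Mn n20 hk; rewrite SE// natrX expr2 mulrA.
  by rewrite ltr_pM2r ?ltr0n// ltNge hn.
have t20 : 0 < t - 2 by rewrite subr_gt0.
(* Chosen so that [q * (t - 2) >= 2], that is, [2 * (q + 1) <= t * q]. *)
pose q := (Num.bound (2 / (t - 2))).+1.
have hq : (q.+1).*2%:R <= t * q%:R.
  have : 2 / (t - 2) <= q%:R.
    apply: (le_trans (ltW (archi_boundP _))); last by rewrite ler_nat.
    by rewrite divr_ge0// ltW.
  rewrite ler_pdivrMr// -mul2n natrM -natr1; lra.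
have [K hK] := upper_deviation X' hP hlam halpha (ltn0Sn q).
exists K.+1 => // n k Kn k0 hk.
have n0 : (0 < n)%N by apply: leq_trans Kn.
have k0' : 0 < k%:R :> R by rewrite ltr0n.
(* Since [t > 1], a lower bound on [n] is also one on [k]. *)
have nk : (n <= k)%N.
  rewrite -(ler_nat R) (le_trans _ hk)// -[leLHS]powRr1// ler_powR ?ler1n//.
  by lra.
(* As [w >= 1], it suffices that [|S k| * n < k]. At the power [2 * (q + 1)] the two factors are
   bounded by [k ^ (q + 2)] and [k ^ q], whose product is [k ^ (2 * (q + 1))]. *)
rewrite SE//; apply: (@lt_le_trans _ _ k%:R); last by rewrite ler_peMl ?ler1n// ltW.
have hS : `|S k| ^+ q.+1.*2 < k%:R ^+ q.+2 by apply: hK; rewrite (leq_trans _ nk)// ltnW.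
rewrite -(@ltr_pXn2r _ q.+1.*2) ?nnegrE ?mulr_ge0// ?ltW// exprMn.
apply: (@lt_le_trans _ _ (k%:R ^+ q.+2 * n%:R ^+ q.+1.*2)).
  by rewrite ltr_pM2r// exprn_gt0// ltr0n.
apply: (@le_trans _ _ (k%:R ^+ q.+2 * k%:R ^+ q)).
  by rewrite ler_wpM2l ?exprn_ge0// (powR_le_root n0 hq hk).
by rewrite -exprD -addnn !addSn addnS.
Qed.
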